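(* Let $P_i\subset\mathbb{E}_i$, $i=1,2$, be $0$-symmetric convex bodies in Euclidean spaces, let $d_i\in\mathbb{N}$, and let $j_i:(\mathbb{E}_i,g_{P_i})\hookrightarrow\ell_\infty^{d_i}$ be linear embeddings with $\|j_i\|=1$ and $\|(j_i)^{-1}\|\le M_i$ (the inverse being defined on $j_i(\mathbb{E}_i)$). Then $$P_1\otimes_{\omega_2}P_2\subset K_G\,(j_1\otimes j_2)^{-1}\left\{B_\infty^{d_1}\otimes_\pi B_\infty^{d_2}\cap(j_1\otimes j_2)(\mathbb{E}_1\otimes\mathbb{E}_2)\right\}\subset K_GM_1M_2\,P_1\otimes_{\omega_2}P_2.$$ In the case where $P_1=\mathcal{E}_1$ is an ellipsoid, $$\mathcal{E}_1\otimes_\epsilon P_2=\mathcal{E}_1\otimes_{\omega_2}P_2\stackrel{K_GM_1M_2}{\simeq}(j_1\otimes j_2)^{-1}\left\{B_\infty^{d_1}\otimes_\pi B_\infty^{d_2}\cap(j_1\otimes j_2)(\mathbb{E}_1\otimes\mathbb{E}_2)\right\},$$ and the analogous statement holds when $P_2=\mathcal{E}_2$ is an ellipsoid.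
   Context: All spaces are real. A Euclidean space is a finite dimensional real inner product space. $\mathbb{E}_1\otimes\mathbb{E}_2$ carries the scalar product determined by $\langle x^1\otimes x^2,y^1\otimes y^2\rangle_H=\langle x^1,y^1\rangle\langle x^2,y^2\rangle$. A convex body is a compact convex set with nonempty interior; it is $0$-symmetric if $P=-P$. The polar of $C$ is $C^\circ=\{y:\sup_{x\in C}\langle x,y\rangle\le1\}$ (with respect to $\langle\cdot,\cdot\rangle_H$ in tensor product spaces). $g_P(x)=\inf\{\lambda>0:\lambda^{-1}x\in P\}$, so $(\mathbb{E},g_P)$ is the normed space with closed unit ball $P$. An ellipsoid in $\mathbb{E}$ is the image of the closed Euclidean unit ball under a linear bijection of $\mathbb{E}$. $B_\infty^d$ is the closed unit ball of $\ell_\infty^d$. For convex bodies $P_i\subset\mathbb{E}_i$ with $0$ in the interior, $P_1\otimes_\pi P_2:=\mathrm{conv}\{x^1\otimes x^2:x^i\in P_i\}$ and $P_1\otimes_\epsilon P_2:=(P_1^\circ\otimes_\pi P_2^\circ)^\circ$. Hilbertian tensor norm: for finite dimensional normed spaces $M,N$ and $u=\sum_k x_k\otimes y_k\in M\otimes N$, let $T_u:M^*\to N$, $T_u(x^* )=\sum_k x^*(x_k)y_k$, and $\omega_2(u):=\inf\{\|R\|\|S\|\}$ over all factorizations $T_u=RS$ of $T_u$ through a Hilbert space. The Hilbertian tensor product of $0$-symmetric convex bodies is $P_1\otimes_{\omega_2}P_2:=\{z\in\mathbb{E}_1\otimes\mathbb{E}_2:\omega_2(z)\le1\}$, with $\omega_2$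 computed on $(\mathbb{E}_1,g_{P_1})\otimes(\mathbb{E}_2,g_{P_2})$. $K_G$ is the (real) Grothendieck constant, i.e. the least constant such that $\pi(u)\le K_G\,\omega_2(u)$ for all $u\in\ell_\infty^m\otimes\ell_\infty^n$ and all $m,n\in\mathbb{N}$, where $\pi(u)=\inf\{\sum_k\|x_k\|\|y_k\|:u=\sum_k x_k\otimes y_k\}$. For $0$-symmetric convex bodies $A,C$ in the same space, $A\stackrel{\lambda}{\simeq}C$ means that the identity between the normed spaces with unit balls $A$ and $C$ is an isomorphism with $\|\mathrm{id}\|\,\|\mathrm{id}^{-1}\|\le\lambda$, i.e. there are $a,b>0$ with $ab\le\lambda$, $A\subset aC$ and $C\subset bA$. *)

(* Defs.v *)
From HB Require Import structures.
From mathcomp Require Import all_boot all_order all_algebra.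
From mathcomp Require Import all_classical all_reals all_analysis.

Set Implicit Arguments.
Unset Strict Implicit.
Unset Printing Implicit Defensive.

Import Order.TTheory GRing.Theory Num.Theory.
Import numFieldNormedType.Exports.

Local Open Scope classical_set_scope.
Local Open Scope ring_scope.

Section TensorProducts.
Variable R : realType.

(** A Euclidean space is a [vectType R] together with a form
    [dot : {dot E for idfun}] (bilinear, symmetric, positive definite).
    Norms take values in [\bar R], so that suprema and infima are never
    assigned junk values. *)

Definition is_tensor_product (E1 E2 T : vectType R)
    (t : {bilinear E1 -> E2 -> T}) : Prop :=
  forall (V : vectType R) (b : {bilinear E1 -> E2 -> V}),
    exists! f : 'Hom(T, V), forall x y, f (t x y) = b x y.

(** [x (x) y] in the usual model of [R^m (x) R^n]; see
    [mx_tens_tensor_product]. *)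
Definition mx_tens m n (x : 'rV[R]_m) (y : 'rV[R]_n) : 'M[R]_(m, n) :=
  x^T *m y.

Lemma mx_tens_bilinear m n : bilinear_for *:%R *:%R (@mx_tens m n).
Proof.
split=> [y a x x'|x a y y']; rewrite /mx_tens.
  by rewrite /applyr linearP mulmxDl -scalemxAl.
by rewrite mulmxDr -scalemxAr.
Qed.

HB.instance Definition _ m n :=
  bilinear_isBilinear.Build R 'rV[R]_m 'rV[R]_n 'M[R]_(m, n) *:%R *:%R
    (@mx_tens m n) (@mx_tens_bilinear m n).

Lemma mx_tens_delta m n (i : 'I_m) (j : 'I_n) :
  mx_tens (delta_mx 0 i) (delta_mx 0 j) = delta_mx i j.
Proof. by rewrite /mx_tens trmx_delta mul_delta_mx. Qed.

Lemma mx_tens_tensor_product m n :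
  is_tensor_product (@mx_tens m n : {bilinear _ -> _ -> _}).
Proof.
move=> V b.
pose g (A : 'M[R]_(m, n)) : V :=
  \sum_i \sum_j A i j *: b (delta_mx 0 i) (delta_mx 0 j).
have g_lin : linear g.
  move=> a A B; rewrite /g scaler_sumr -big_split; apply: eq_bigr => i _ /=.
  rewrite scaler_sumr -big_split; apply: eq_bigr => j _ /=.
  by rewrite !mxE scalerDl scalerA.
pose gL := GRing.isLinear.Build R 'M[R]_(m, n) V *:%R g g_lin.
pose g' : {linear 'M[R]_(m, n) -> V} := HB.pack g gL.
exists (linfun g'); split=> [x y|f hf].
  rewrite lfunE /= /g [in RHS](row_sum_delta x) linear_sumlz.
  apply: eq_bigr => i _; rewrite linearZl_LR [in RHS](row_sum_delta y).
  rewrite linear_sumr scaler_sumr; apply: eq_bigr => j _.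
  by rewrite linearZr_LR scalerA !mxE big_ord1 mxE.
have hf' x y : f (mx_tens x y) = b x y := hf x y.
apply/lfunP => A; rewrite lfunE /= /g [in RHS](matrix_sum_delta A).
rewrite linear_sum; apply: eq_bigr => i _.
rewrite linear_sum; apply: eq_bigr => j _.
by rewrite linearZ_LR /= -hf' mx_tens_delta.
Qed.

Definition dual (E : vectType R) := 'Hom(E, R^o).

Definition opnorm (V W : lmodType R) (D : set V)
    (p : V -> \bar R) (q : W -> \bar R) (f : V -> W) : \bar R :=
  ereal_sup [set q (f x) | x in [set x | D x /\ (p x <= 1)%E]].

Definition dual_norm (E : vectType R) (p : E -> \bar R) (f : dual E) : \bar R :=
  opnorm setT p (fun r : R^o => `|r|%:E) f.

Definition gauge_fun (E : lmodType R) (P : set E) (x : E) : \bar R :=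
  ereal_inf [set l%:E | l in [set l : R | 0 < l /\ P (l^-1 *: x)]].

(** The library norm on ['rV[R]_d] is the maximum norm. *)
Definition linf_norm d (x : 'rV[R]_d) : \bar R := `|x|%:E.

Definition linf_ball d : set 'rV[R]_d := [set x | `|x| <= 1].

Definition coords (E : vectType R) : E -> 'rV[R]_(\dim {:E}) :=
  passmx.rVof (vbasis {:E}).

(** A finite dimensional space has a unique Hausdorff vector space topology,
    so topological notions are transported along [coords]. *)
Definition convex_body (E : vectType R) (P : set E) : Prop :=
  [/\ convex_set (P : set (convex_lmodType E)),
      compact (@coords E @` P) & (@coords E @` P)^° !=set0].

Definition symmetric_body (E : vectType R) (P : set E) : Prop :=
  convex_body P /\ [set - x | x in P] = P.

Definition ellipsoid (E : vectType R) (dot : {dot E for idfun}) (P : set E) :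
    Prop :=
  exists2 A : 'End(E), bijective A &
    P = A @` [set x | Num.sqrt (dot x x) <= 1].

Definition polar (E : vectType R) (dot : {dot E for idfun}) (C : set E) :
    set E :=
  [set y | (ereal_sup [set (dot x y)%:E | x in C] <= 1)%E].

Definition convex_hull (E : lmodType R) (A : set E) : set E :=
  smallest (@convex_set R E) A.

Definition scale_set (E : lmodType R) (a : R) (A : set E) : set E :=
  [set a *: x | x in A].

Definition body_equiv (E : lmodType R) (lambda : R) (A C : set E) : Prop :=
  exists a b : R, [/\ 0 < a, 0 < b, a * b <= lambda,
    A `<=` scale_set a C & C `<=` scale_set b A].

Section Norms.
Variables (E1 E2 T : vectType R) (t : {bilinear E1 -> E2 -> T}).

Definition pi_body (P1 : set E1) (P2 : set E2) : set T :=
  convex_hull [set t x.1 x.2 | x in P1 `*` P2].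

Definition eps_body (dot1 : {dot E1 for idfun}) (dot2 : {dot E2 for idfun})
    (dotT : {dot T for idfun}) (P1 : set E1) (P2 : set E2) : set T :=
  polar dotT (pi_body (polar dot1 P1) (polar dot2 P2)).

Definition pi_norm (p : E1 -> \bar R) (q : E2 -> \bar R) (u : T) : \bar R :=
  ereal_inf [set c | exists n (x : 'I_n -> E1) (y : 'I_n -> E2),
    u = \sum_k t (x k) (y k) /\ c = (\sum_k p (x k) * q (y k))%E].

(** [A] is the operator [T_u] associated with [u]; it does not depend on the
    representation of [u]. *)
Definition tensor_operator (u : T) (A : dual E1 -> E2) : Prop :=
  exists n (x : 'I_n -> E1) (y : 'I_n -> E2),
    u = \sum_k t (x k) (y k) /\
    forall f : dual E1, A f = \sum_k (f (x k) : R) *: y k.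

Definition omega2 (p : E1 -> \bar R) (q : E2 -> \bar R) (u : T) : \bar R :=
  ereal_inf [set c | exists (H : completeNormedModType R)
      (dot : {dot H for idfun})
      (S : {linear dual E1 -> H}) (Q : {linear H -> E2}),
    let normH := fun h : H => `|h|%:E in
    let normS := opnorm setT (dual_norm p) normH S in
    let normQ := opnorm setT normH q Q in
    [/\ forall h : H, `|h| = Num.sqrt (dot h h),
        tensor_operator u (Q \o S),
        (normS < +oo)%E, (normQ < +oo)%E & c = (normQ * normS)%E]].

Definition omega2_body (P1 : set E1) (P2 : set E2) : set T :=
  [set z | (omega2 (gauge_fun P1) (gauge_fun P2) z <= 1)%E].

End Norms.

Definition grothendieck_constant : R :=
  inf [set K : R | forall m n (u : 'M[R]_(m, n)),
    (pi_norm (@mx_tens m n) (@linf_norm m) (@linf_norm n) u <=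
     K%:E * omega2 (@mx_tens m n) (@linf_norm m) (@linf_norm n) u)%E].

(** [j] embeds [(E, g_P)] into [l_oo^d] with [|j| = 1] and [|j^-1| <= M],
    where [j^-1] is normed as an operator on the range of [j]. *)
Definition linf_embedding (E : vectType R) (P : set E) d
    (j : 'Hom(E, 'rV[R]_d)) (M : R) : Prop :=
  [/\ injective j,
      opnorm setT (gauge_fun P) (@linf_norm d) j = 1%E &
      (opnorm [set y | y \in limg j] (@linf_norm d) (gauge_fun P) (j^-1)%VF
         <= M%:E)%E].

End TensorProducts.

(* Main.v *)
Require Import Defs.
From HB Require Import structures.
From mathcomp Require Import all_boot all_order all_algebra.
From mathcomp Require Import all_classical all_reals all_analysis.
From mathcomp Require Import ring lra.
Import Order.TTheory GRing.Theory Num.Theory.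
Import numFieldNormedType.Exports.
Local Open Scope classical_set_scope.
Local Open Scope ring_scope.

(** Everything is reduced to one description of the Hilbertian norm. If
    [z = \sum_k t (x k) (y k)] and both maps [h |-> \sum_k h k *: x k] and
    [h |-> \sum_k h k *: y k] are contractions from l_2^N, then the operator
    of [z] factors through l_2^N with constant 1, so [omega2 z <= 1]
    ([omega2_le]).

    First inclusion. Composing a factorization of [T_z] with [j2] and the
    adjoint of [j1] gives one of [T_(J z)] that is no worse
    ([omega2_embedding]); Grothendieck's inequality then bounds
    [pi (J z)], and a tensor with [pi <= 1] belongs to the projective ball
    because that ball is a polytope, hence closed ([pi_norm_le1_body]).

    The constant [K_G] is defined as an infimum, so the argument needs that
    some constant works and that the infimum does. Existence is proved by
    truncation in place of Gaussian variables: random signs embed l_2^N in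
    some L_2 with fourth moments under control ([rademacher]), so cutting the
    variables off at 7 times their norm leaves a tail of norm at most 1/4; the
    bounded parts form an average of 49-bounded elementary tensors, and the
    tails are covered by the inequality that is being proved
    ([gram_bound_step]). Iterating from a dimension dependent bound gives the
    universal constant 99 ([grothendieck_gram]). A Gram-Schmidt argument
    reduces an arbitrary Hilbert space to l_2^N ([pi_le_hilbert]).

    Second inclusion. Elements of the projective ball of l_oo have the form
    [X^T *m Y] with [X] and [Y] contractions from l_2^N to l_oo
    ([pi_body_hilbert]). When the matrix lies in the range of [J], one may
    replace l_2^N by the subspace that [X] sends into the range of [j1], and
    then by the subspace that [Y] sends into the range of [j2]; orthogonal
    projections onto these subspaces do not change the product
    ([hilbert_restrict2]). Pulling back by the inverses of [j1] and [j2] costs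
    [M1 * M2] ([pi_body_omega2]).

    Ellipsoids. In general [eps <= omega2] ([omega2_sub_eps]). If [P1] is an
    ellipsoid, [(E1, g_P1)] is itself a Hilbert space: expanding [z] along an
    orthonormal basis of it makes the first map above an isometry, and the
    bipolar theorem turns [eps z <= 1] into the statement that the second map
    is a contraction ([ellipsoid_frame], [frame_gauge]). *)

Set Implicit Arguments.
Unset Strict Implicit.
Unset Printing Implicit Defensive.

(** * Upper bounds for the projective norm of matrices *)

Section PiBounds.
Variable R : realType.

(** A bound on [pi u] together with a representation that achieves it. Keeping
    the witness makes the bounds add and scale by plain real arithmetic. *)
Definition pi_le m n (u : 'M[R]_(m, n)) (c : R) : Prop :=
  exists k (x : 'I_k -> 'rV[R]_m) (y : 'I_k -> 'rV[R]_n),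
    u = \sum_i mx_tens (x i) (y i) /\ \sum_i `|x i| * `|y i| <= c.

Lemma pi_le0 m n : pi_le (0 : 'M[R]_(m, n)) 0.
Proof.
by exists 0%N, (fun=> 0), (fun=> 0); rewrite !big_ord0.
Qed.

Lemma pi_le_tens m n (x : 'rV[R]_m) (y : 'rV[R]_n) a b :
  `|x| <= a -> `|y| <= b -> pi_le (mx_tens x y) (a * b).
Proof.
move=> xa yb; exists 1%N, (fun=> x), (fun=> y); rewrite !big_ord1; split=> //.
by rewrite ler_pM.
Qed.

Lemma pi_leD m n (u v : 'M[R]_(m, n)) a b :
  pi_le u a -> pi_le v b -> pi_le (u + v) (a + b).
Proof.
move=> [k [x [y [-> xa]]]] [l [x' [y' [-> xb]]]].
exists (k + l)%N,
  (fun i : 'I_(k + l) =>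
     match fintype.split i with inl j => x j | inr j => x' j end),
  (fun i : 'I_(k + l) =>
     match fintype.split i with inl j => y j | inr j => y' j end).
split.
  rewrite big_split_ord /=; congr (_ + _); apply: eq_bigr => i _.
    by rewrite (unsplitK (inl i)).
  by rewrite (unsplitK (inr i)).
rewrite big_split_ord /= lerD//.
  by rewrite (eq_bigr (fun i => `|x i| * `|y i|)) // => i _; rewrite (unsplitK (inl i)).
by rewrite (eq_bigr (fun i => `|x' i| * `|y' i|)) // => i _; rewrite (unsplitK (inr i)).
Qed.

Lemma pi_le_sum m n (I : Type) (s : seq I) (u : I -> 'M[R]_(m, n)) (c : I -> R) :
  (forall i, pi_le (u i) (c i)) -> pi_le (\sum_(i <- s) u i) (\sum_(i <- s) c i).
Proof.
move=> h; elim: s => [|i s ih]; first by rewrite !big_nil; exact: pi_le0.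
by rewrite !big_cons; apply: pi_leD.
Qed.

Lemma pi_leZ m n (u : 'M[R]_(m, n)) a c :
  0 <= a -> pi_le u c -> pi_le (a *: u) (a * c).
Proof.
move=> a0 [k [x [y [-> xc]]]]; exists k, (fun i => a *: x i), y; split.
  rewrite scaler_sumr; apply: eq_bigr => i _.
  by rewrite /mx_tens linearZ /= scalemxAl.
under eq_bigr do rewrite normrZ (ger0_norm a0) -mulrA.
by rewrite -mulr_sumr ler_wpM2l.
Qed.

Lemma pi_le_weaken m n (u : 'M[R]_(m, n)) c c' : pi_le u c -> c <= c' -> pi_le u c'.
Proof.
by move=> [k [x [y [-> xc]]]] cc; exists k, x, y; split=> //; exact: le_trans cc.
Qed.

Lemma row_norm_le n (x : 'rV[R]_n) c :
  0 <= c -> (forall i, `|x 0 i| <= c) -> `|x| <= c.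
Proof.
move=> c0 h; rewrite [leLHS]/Num.norm/= mx_normrE (bigmax_le _ c0)//= => -[i j] _.
by rewrite /= ord1.
Qed.

Lemma row_entry_le n (x : 'rV[R]_n) i : `|x 0 i| <= `|x|.
Proof.
by rewrite [leRHS]/Num.norm/= mx_normrE; apply/bigmax_geP; right => /=; exists (0, i).
Qed.

Lemma pi_le_norm m n (u : 'M[R]_(m, n)) c : pi_le u c ->
  (pi_norm (@mx_tens R m n) (@linf_norm R m) (@linf_norm R n) u <= c%:E)%E.
Proof.
move=> [k [x [y [-> xc]]]]; apply: (@le_trans _ _ (\sum_i `|x i| * `|y i|)%:E).
  apply: ereal_inf_lbound; exists k, x, y; split=> //.
  by rewrite sumEFin.
by rewrite lee_fin.
Qed.

End PiBounds.

(** * Random signs *)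

Section Rademacher.
Variable R : realType.

Definition edot N (u v : 'rV[R]_N) : R := (u *m v^T) 0 0.

Lemma edotE N (u v : 'rV[R]_N) : edot u v = \sum_k u 0 k * v 0 k.
Proof. by rewrite /edot mxE; apply: eq_bigr => k _; rewrite mxE. Qed.

(** The columns of [E] are taken to be the [K = 2 ^ N] sign vectors, so [a *m E] lists the
    values of the random sum with coefficients [a]. The second moments give an
    isometry up to the factor [K], and the fourth moments satisfy the Gaussian
    bound: adding an independent [c] or [- c] to a variable [Y] with
    [E Y^2 = s] gives [E (Y + c)^4 = E Y^4 + 6 c^2 s + c^4], which is at most
    [3 (s + c^2)^2] when [E Y^4 <= 3 s^2]. *)
Lemma rademacher N : exists K (E : 'M[R]_(N, K)),
  [/\ (0 < K)%N, E *m E^T = K%:R%:M &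
     forall a : 'rV[R]_N,
       \sum_k (a *m E) 0 k ^+ 4 <= 3 * K%:R * (edot a a) ^+ 2].
Proof.
elim: N => [|N [K [E [K0 EE h4]]]].
  exists 1%N, 0; split=> //; first by apply/matrixP => -[].
  move=> a; rewrite big1 => [|k _]; first exact: (mulr_ge0 _ (sqr_ge0 _)).
  by rewrite mulmx0 mxE expr0n.
pose F : 'M[R]_(1 + N, K + K) := block_mx (const_mx 1) (const_mx (- 1)) E E.
have cc (c d : R) : (const_mx c : 'M[R]_(1, K)) *m (const_mx d)^T = (K%:R * (c * d))%:M.
  apply/matrixP => i j; rewrite !ord1 !mxE eqxx mulr1n.
  by under eq_bigr do rewrite !mxE; rewrite sumr_const card_ord mulr_natl.
have constN : (const_mx (-1) : 'M[R]_(1, K)) = - const_mx 1.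
  by apply/matrixP => i j; rewrite !mxE.
have FF : F *m F^T = (K + K)%:R%:M.
  rewrite /F tr_block_mx mulmx_block !cc !EE constN linearN /= mulNmx mulmxN.
  rewrite !subrr -!raddfD /= !mulr1 [RHS]scalar_mx_block.
  by congr block_mx; rewrite mulrNN !mulr1 natrD.
suff F4 (a : 'rV[R]_(1 + N)) :
    \sum_k (a *m F) 0 k ^+ 4 <= 3 * (K + K)%:R * edot a a ^+ 2.
  by exists (K + K)%N, F; split; [rewrite addn_gt0 K0 | exact: FF | exact: F4].
rewrite -[a]hsubmxK; set al := lsubmx a; set b := rsubmx a.
have -> : row_mx al b *m F =
    row_mx (b *m E + const_mx (al 0 0)) (b *m E - const_mx (al 0 0)).
  rewrite /F mul_row_block addrC; congr row_mx.
    congr (_ + _); apply/matrixP => i j; rewrite !ord1 !mxE big_ord1 !mxE mulr1 //.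
  rewrite addrC; congr (_ + _); apply/matrixP => i j.
  by rewrite !ord1 !mxE big_ord1 !mxE mulrN1.
have -> : edot (row_mx al b) (row_mx al b) = al 0 0 ^+ 2 + edot b b.
  rewrite /edot tr_row_mx mul_row_col [LHS]mxE [X in X + _]mxE big_ord1.
  by rewrite [X in _ * X]mxE expr2.
rewrite big_split_ord /= -big_split /=.
set c := al 0 0; set s := edot b b.
have s2 : \sum_k (b *m E) 0 k ^+ 2 = K%:R * s.
  have -> : K%:R * s = (b *m E *m (b *m E)^T) 0 0.
    by rewrite trmx_mul mulmxA -(mulmxA b) EE mul_mx_scalar -scalemxAl mxE.
  by rewrite mxE; apply: eq_bigr => k _; rewrite expr2 [X in _ = _ * X]mxE.
rewrite (eq_bigr (fun k => 2 * (b *m E) 0 k ^+ 4 +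
    (12 * c ^+ 2 * (b *m E) 0 k ^+ 2 + 2 * c ^+ 4))); last first.
  by move=> k _; rewrite row_mxEl row_mxEr !mxE; ring.
rewrite big_split /= big_split /= -!mulr_sumr s2 sumr_const card_ord.
rewrite -[_ *+ K]mulr_natl natrD.
have := h4 b; rewrite -/s => h.
have K0' : (0:R) <= K%:R by [].
have c4 : 0 <= K%:R * c ^+ 4 by rewrite mulr_ge0// exprn_even_ge0.
lra.
Qed.

End Rademacher.

(** * Grothendieck's inequality for Gram matrices *)

Section Grothendieck.
Variable R : realType.

Lemma edot_ge0 N (u : 'rV[R]_N) : 0 <= edot u u.
Proof. by rewrite edotE sumr_ge0// => k _; rewrite -expr2 sqr_ge0. Qed.

Lemma edot_eq0 N (u : 'rV[R]_N) : edot u u = 0 -> u = 0.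
Proof.
rewrite edotE => h; apply/rowP => k; rewrite mxE; apply/eqP.
have /psumr_eq0P/(_ h)/(_ k isT)/eqP : forall i : 'I_N, true -> 0 <= u 0 i * u 0 i.
  by move=> i _; rewrite -expr2 sqr_ge0.
by rewrite mulf_eq0 orbb.
Qed.

Lemma edotC N (u v : 'rV[R]_N) : edot u v = edot v u.
Proof. by rewrite !edotE; apply: eq_bigr => k _; rewrite mulrC. Qed.

Lemma edotDl N (u v w : 'rV[R]_N) : edot (u + v) w = edot u w + edot v w.
Proof. by rewrite /edot mulmxDl mxE. Qed.

Lemma edotZl N a (u v : 'rV[R]_N) : edot (a *: u) v = a * edot u v.
Proof. by rewrite /edot -scalemxAl mxE. Qed.

Lemma edotDr N (u v w : 'rV[R]_N) : edot w (u + v) = edot w u + edot w v.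
Proof. by rewrite edotC edotDl !(edotC w). Qed.

Lemma edotZr N a (u v : 'rV[R]_N) : edot v (a *: u) = a * edot v u.
Proof. by rewrite edotC edotZl edotC. Qed.

Lemma edot_CS N (u v : 'rV[R]_N) : edot u v ^+ 2 <= edot u u * edot v v.
Proof.
have [v0|v0] := eqVneq (edot v v) 0.
  by rewrite (edot_eq0 v0) /edot trmx0 !mulmx0 !mxE expr0n mulr0.
have vp : 0 < edot v v by rewrite lt_def v0 edot_ge0.
have := edot_ge0 (edot v v *: u + (- edot u v) *: v).
rewrite !(edotDl, edotDr, edotZl, edotZr) (edotC v u).
set a := edot u u; set b := edot v v in vp *; set c := edot u v.
rewrite [leRHS](_ : _ = b * (a * b - c ^+ 2)); last by ring.
by rewrite pmulr_rge0// subr_ge0.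
Qed.

Lemma edot_le N (u v : 'rV[R]_N) r s : 0 <= r -> 0 <= s ->
  edot u u <= r ^+ 2 -> edot v v <= s ^+ 2 -> `|edot u v| <= r * s.
Proof.
move=> r0 s0 ur vs; rewrite -ler_sqr ?nnegrE ?mulr_ge0// real_normK ?num_real//.
by rewrite (le_trans (edot_CS u v))// exprMn ler_pM ?edot_ge0.
Qed.

(** Grothendieck's inequality with constant [C] for [m x n] matrices. The
    length [N] of the vectors is not bounded, since the inductive step replaces
    vectors of length [N] by random variables on a larger finite space. *)
Definition gram_bound m n (C : R) : Prop :=
  forall N (A : 'M[R]_(m, N)) (B : 'M[R]_(n, N)) r s, 0 <= r -> 0 <= s ->
    (forall i, edot (row i A) (row i A) <= r ^+ 2) ->
    (forall j, edot (row j B) (row j B) <= s ^+ 2) ->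
    pi_le (A *m B^T) (C * r * s).

Lemma gram_entry m n N (A : 'M[R]_(m, N)) (B : 'M[R]_(n, N)) i j :
  (A *m B^T) i j = edot (row i A) (row j B).
Proof. by rewrite edotE mxE; apply: eq_bigr => k _; rewrite !mxE. Qed.

(** Decomposing along the rows costs a factor [m]; the constant is useful only
    as the start of an iteration. *)
Lemma gram_bound_apriori m n : gram_bound m n m%:R.
Proof.
move=> N A B r s r0 s0 hA hB.
have -> : A *m B^T = \sum_i mx_tens (delta_mx 0 i) (row i (A *m B^T)).
  apply/matrixP => i j; rewrite summxE (bigD1 i)//= big1 => [|k ki].
    by rewrite addr0 [RHS]mxE big_ord1 !mxE !eqxx mul1r.
  by rewrite [LHS]mxE big_ord1 !mxE eqxx eq_sym (negPf ki) mul0r.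
have -> : m%:R * r * s = \sum_(i < m) (1 * (r * s)).
  by rewrite sumr_const card_ord mul1r -[RHS]mulr_natl mulrA.
apply: pi_le_sum => i; apply: pi_le_tens; apply: row_norm_le => //.
- by move=> j; rewrite !mxE eqxx /=; case: eqP; rewrite ?normr1 ?normr0.
- exact: mulr_ge0.
- by move=> j; rewrite mxE gram_entry edot_le.
Qed.

(** Values beyond [M] are sent to 0, not to [M], so that [x - clip M x] vanishes
    unless [M < `|x|], which gives the Chebyshev bound [clip_tail]. *)
Definition clip (M x : R) : R := if `|x| <= M then x else 0.

Lemma clip_norm M x : 0 <= M -> `|clip M x| <= M.
Proof. by rewrite /clip; case: ifP => // _; rewrite normr0. Qed.

Lemma clip_sqr M x : clip M x * clip M x <= x * x.
Proof. by rewrite /clip; case: ifP => // _; rewrite mulr0 -expr2 sqr_ge0. Qed.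

Lemma clip_tail M x : 0 <= M -> M ^+ 2 * ((x - clip M x) * (x - clip M x)) <= x ^+ 4.
Proof.
move=> M0; rewrite /clip; case: ifPn => [_|].
  by rewrite subrr !mulr0 exprn_even_ge0.
rewrite -ltNge subr0 => xM; rewrite -expr2.
rewrite (_ : x ^+ 4 = x ^+ 2 * x ^+ 2); last by rewrite -exprD.
rewrite ler_wpM2r ?sqr_ge0// -(real_normK (num_real x)) ler_sqr ?nnegrE//.
exact: ltW.
Qed.

Lemma gram_zero m n N (A : 'M[R]_(m, N)) (B : 'M[R]_(n, N)) :
  (forall i, edot (row i A) (row i A) <= 0) -> A *m B^T = 0.
Proof.
move=> h; suff -> : A = 0 by rewrite mul0mx.
apply/row_matrixP => i; rewrite row0; apply: edot_eq0; apply/eqP.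
by rewrite eq_le h edot_ge0.
Qed.

(** With [X] and [Y] the random variables attached to the two families, clipped
    at [7 r] and [7 s] to [X1] and [Y1],
    [X Y^T = X1 Y1^T + (X - X1) Y1^T + X (Y - Y1)^T]. The first term is an
    average of rank one matrices of projective norm at most [49 r s]. By the
    fourth moment bound the tails have norm at most [sqrt (3 / 49) <= 1 / 4]
    times [r] and [s], so the hypothesis applied to the two other terms gives
    [C / 4] twice. *)
Lemma gram_bound_step m n C : gram_bound m n C -> gram_bound m n (49 + C / 2).
Proof.
move=> hC N A B r s; rewrite !le0r => /orP[/eqP->|r0] /=.
  move=> _ hA _; rewrite mulr0 mul0r gram_zero; first exact: pi_le0.
  by move=> i; rewrite (le_trans (hA i))// expr0n.
move=> /orP[/eqP->|s0].
  move=> _ hB; rewrite mulr0 -[A *m _]trmxK trmx_mul trmxK gram_zero ?trmx0.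
    exact: pi_le0.
  by move=> i; rewrite (le_trans (hB i))// expr0n.
(* [k] is the norm of the constant 1 in the unnormalized L_2 space. *)
move=> hA hB; have [K [E [K0 EE h4]]] := rademacher R N.
pose k := Num.sqrt (K%:R : R).
have K0' : 0 < (K%:R : R) by rewrite ltr0n.
have kk : k ^+ 2 = K%:R by rewrite sqr_sqrtr// ltW.
have k0 : 0 <= k by exact: sqrtr_ge0.
pose tr M p (X : 'M[R]_(p, K)) := map_mx (clip M) X.
pose X := A *m E; pose X1 := tr (7 * r) m X; pose X2 := X - X1.
pose Y := B *m E; pose Y1 := tr (7 * s) n Y; pose Y2 := Y - Y1.
have gramE p (D : 'M[R]_(p, N)) i : edot (row i (D *m E)) (row i (D *m E)) =
    K%:R * edot (row i D) (row i D).
  rewrite row_mul /edot trmx_mul mulmxA -(mulmxA (row i D)) EE.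
  by rewrite mul_mx_scalar -scalemxAl mxE.
have ctr p M (Z : 'M[R]_(p, K)) i :
    edot (row i (tr M p Z)) (row i (tr M p Z)) <= edot (row i Z) (row i Z).
  by rewrite !edotE ler_sum// => l _; rewrite !mxE clip_sqr.
have tail p (D : 'M[R]_(p, N)) c i : 0 < c -> edot (row i D) (row i D) <= c ^+ 2 ->
    edot (row i (D *m E - tr (7 * c) p (D *m E)))
         (row i (D *m E - tr (7 * c) p (D *m E))) <= (k * (c / 4)) ^+ 2.
  move=> c0 hD; have M0 : 0 <= 7 * c by rewrite mulr_ge0// ltW.
  have M1 : 0 < (7 * c) ^+ 2 by rewrite exprn_gt0// mulr_gt0.
  rewrite -(ler_pM2l M1) edotE mulr_sumr.
  apply: (@le_trans _ _ (\sum_l (row i D *m E) 0 l ^+ 4)).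
    by apply: ler_sum => l _; rewrite -row_mul !mxE clip_tail.
  apply: (le_trans (h4 _)); rewrite !exprMn kk.
  have := edot_ge0 (row i D); set e := edot _ _ in hD * => e0.
  have : e ^+ 2 <= (c ^+ 2) ^+ 2 by rewrite ler_sqr ?nnegrE// sqr_ge0.
  have := sqr_ge0 (c ^+ 2); set q := (c ^+ 2) ^+ 2 => q0 eq.
  rewrite exprVn (_ : 7 ^+ 2 * c ^+ 2 * (K%:R * (c ^+ 2 / 4 ^+ 2)) =
    49 / 16 * (K%:R * q)); last by rewrite /q; field.
  rewrite -mulrA; have : K%:R * e ^+ 2 <= K%:R * q by rewrite ler_wpM2l// ltW.
  have : 0 <= K%:R * q by rewrite mulr_ge0// ltW.
  by lra.
have -> : A *m B^T = K%:R^-1 *: (X1 *m Y1^T + (X2 *m Y1^T + X *m Y2^T)).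
  rewrite addrA -mulmxDl /X2 addrCA subrr addr0 -mulmxDr -linearD /= /Y2.
  rewrite addrCA subrr addr0.
  rewrite /X /Y trmx_mul mulmxA -(mulmxA A) EE mul_mx_scalar -scalemxAl scalerA.
  by rewrite mulVf ?scale1r// gt_eqF.
have -> : (49 + C / 2) * r * s = K%:R^-1 * (K%:R * ((7 * r) * (7 * s)) +
   (C * (k * (r / 4)) * (k * s) + C * (k * r) * (k * (s / 4)))).
  rewrite (_ : C * (k * (r / 4)) * (k * s) = C * k ^+ 2 * r * s / 4); last by ring.
  rewrite (_ : C * (k * r) * (k * (s / 4)) = C * k ^+ 2 * r * s / 4); last by ring.
  by rewrite kk; field; rewrite gt_eqF.
have bd p (D : 'M[R]_(p, N)) c i : edot (row i D) (row i D) <= c ^+ 2 ->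
    edot (row i (D *m E)) (row i (D *m E)) <= (k * c) ^+ 2.
  by move=> h; rewrite gramE exprMn kk ler_wpM2l// ltW.
apply: pi_leZ; first by rewrite invr_ge0 ltW.
apply: pi_leD; last apply: pi_leD.
- have -> : X1 *m Y1^T = \sum_l mx_tens (col l X1)^T (col l Y1)^T.
    apply/matrixP => i j; rewrite summxE mxE; apply: eq_bigr => l _.
    by rewrite [RHS]mxE big_ord1 !mxE.
  have -> : K%:R * (7 * r * (7 * s)) = \sum_(l < K) 7 * r * (7 * s).
    by rewrite sumr_const card_ord mulr_natl.
  apply: pi_le_sum => l.
  have r7 : 0 <= 7 * r by rewrite mulr_ge0// ltW.
  have s7 : 0 <= 7 * s by rewrite mulr_ge0// ltW.
  by apply: pi_le_tens; apply: row_norm_le => // i; rewrite !mxE clip_norm.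
- apply: hC; rewrite ?mulr_ge0 ?divr_ge0 ?(ltW r0) ?(ltW s0)// => i; first exact: tail.
  by apply: (le_trans (ctr _ _ _ _)); exact: bd.
- by apply: hC; rewrite ?mulr_ge0 ?divr_ge0 ?(ltW r0) ?(ltW s0)// => i; [exact: bd|exact: tail].
Qed.

Lemma gram_bound_le m n C C' : C <= C' -> gram_bound m n C -> gram_bound m n C'.
Proof.
move=> CC h N A B r s r0 s0 hA hB; apply: (pi_le_weaken (h _ _ _ _ _ r0 s0 hA hB)).
by rewrite !ler_wpM2r.
Qed.

(** The map [C |-> 49 + C / 2] halves the distance to its fixed point 98, so
    enough steps bring the dimension dependent constant below 99. *)
Lemma grothendieck_gram m n : gram_bound m n 99.
Proof.
suff h k : exists2 C, gram_bound m n C & C <= 98 + m%:R / 2 ^+ k.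
  have [k hk] : exists k, (m <= 2 ^ k)%N.
    by exists m; rewrite ltnW// ltn_expl.
  have [C hC Cle] := h k; apply: gram_bound_le hC; apply: (le_trans Cle).
  rewrite (_ : 99 = 98 + 1); last by ring.
  by rewrite lerD2l ler_pdivrMr ?exprn_gt0// mul1r -natrX ler_nat.
elim: k => [|k [C hC Cle]].
  by exists m%:R; [exact: gram_bound_apriori | rewrite expr0 divr1 lerDr].
exists (49 + C / 2); first exact: gram_bound_step.
rewrite exprS invfM mulrCA; set q := _ / 2 ^+ k in Cle *.
lra.
Qed.

End Grothendieck.

(** * Finite dimensional Hilbert spaces *)

(** The space l_2^N. It is a separate type because row vectors already carry the
    maximum norm. *)
Definition euclid (R : realType) (N : nat) : Type := 'rV[R]_N.

Section Euclid.
Variable R : realType.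

Definition enorm N (u : 'rV[R]_N) : R := Num.sqrt (edot u u).

Lemma enorm_ge0 N (u : 'rV[R]_N) : 0 <= enorm u.
Proof. exact: sqrtr_ge0. Qed.

Lemma enorm_sqr N (u : 'rV[R]_N) : enorm u ^+ 2 = edot u u.
Proof. by rewrite sqr_sqrtr// edot_ge0. Qed.

Lemma enormZ N a (u : 'rV[R]_N) : enorm (a *: u) = `|a| * enorm u.
Proof.
by rewrite /enorm edotZl edotZr mulrA -expr2 sqrtrM ?sqr_ge0// sqrtr_sqr.
Qed.

Lemma enorm_eq0 N (u : 'rV[R]_N) : enorm u = 0 -> u = 0.
Proof. by move=> u0; apply: edot_eq0; rewrite -enorm_sqr u0 expr0n. Qed.

Lemma enorm0 N : enorm (0 : 'rV[R]_N) = 0.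
Proof. by rewrite -(scale0r 0) enormZ normr0 mul0r. Qed.

Lemma edot_enorm N (u v : 'rV[R]_N) : `|edot u v| <= enorm u * enorm v.
Proof. by apply: edot_le; rewrite ?enorm_ge0 ?enorm_sqr. Qed.

Lemma enormD N (u v : 'rV[R]_N) : enorm (u + v) <= enorm u + enorm v.
Proof.
rewrite -ler_sqr ?nnegrE ?addr_ge0 ?enorm_ge0// enorm_sqr sqrrD !enorm_sqr.
rewrite edotDl !edotDr (edotC v u).
have := le_trans (ler_norm _) (edot_enorm u v).
by rewrite -mulr_natl; lra.
Qed.

HB.instance Definition _ N := GRing.Lmodule.on (euclid R N).
HB.instance Definition _ N := Lmodule_isNormed.Build R (euclid R N)
  (@enormD N) (@enormZ N) (@enorm_eq0 N).

Lemma euclid_normE N (u : euclid R N) : `|u| = enorm u.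
Proof. by []. Qed.

Lemma entry_le_enorm N (u : 'rV[R]_N) k : `|u 0 k| <= enorm u.
Proof.
rewrite -ler_sqr ?nnegrE ?enorm_ge0// enorm_sqr real_normK ?num_real// edotE.
by rewrite (bigD1 k)//= -expr2 lerDl sumr_ge0// => i _; rewrite -expr2 sqr_ge0.
Qed.

Lemma norm_le_enorm N (u : 'rV[R]_N) : `|u| <= enorm u.
Proof.
by apply: row_norm_le => [|k]; [exact: enorm_ge0|exact: entry_le_enorm].
Qed.

Lemma enorm_le_norm N (u : 'rV[R]_N) : enorm u <= N%:R * `|u|.
Proof.
rewrite [in leLHS](row_sum_delta u).
apply: (@le_trans _ _ (\sum_(k < N) `|u 0 k|)).
  apply: (big_ind2 (fun (v : 'rV[R]_N) c => enorm v <= c)) => [|v c w d vc wd|k _].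
  - by rewrite enorm0.
  - by apply: (le_trans (enormD _ _)); rewrite lerD.
  rewrite enormZ (_ : enorm _ = 1) ?mulr1// /enorm edotE (bigD1 k)//= big1 => [|i ik].
    by rewrite !mxE !eqxx addr0 mulr1 sqrtr1.
  by rewrite !mxE (negPf ik) mul0r.
have -> : N%:R * `|u| = \sum_(k < N) `|u| by rewrite sumr_const card_ord mulr_natl.
by apply: ler_sum => k _; exact: row_entry_le.
Qed.

(** The Euclidean norm and the maximum norm are equivalent, so completeness is
    inherited from row vectors. *)
Lemma euclid_complete N (F : set_system (euclid R N)) :
  ProperFilter F -> cauchy F -> cvg F.
Proof.
move=> FF /cauchyP Fc.
have Fc' : cauchy (F : set_system 'rV[R]_N).
  apply/cauchyP => e e0; have [x Fx] := Fc _ e0.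
  exists x; apply: filterS Fx => y; rewrite -!ball_normE /=.
  exact: le_lt_trans (norm_le_enorm _).
have := @cauchy_cvg _ (F : set_system 'rV[R]_N) FF Fc'.
move=> /cvg_ex[x Fx]; apply/cvg_ex; exists x.
apply/cvgrPdist_lt => e e0.
have e1 : 0 < e / N.+1%:R by rewrite divr_gt0.
move/cvgrPdist_lt: Fx => /(_ _ e1); apply: filterS => y.
rewrite ltr_pdivlMr// => xy; rewrite euclid_normE.
apply: le_lt_trans xy; rewrite mulrC.
apply: (le_trans (enorm_le_norm _)).
by rewrite ler_wpM2r// ler_nat.
Qed.

HB.instance Definition _ N := Uniform_isComplete.Build (euclid R N)
  (@euclid_complete N).

Definition euclid_dot N : euclid R N -> euclid R N -> R := @edot R N.

Lemma euclid_dot_hermitian N (x y : euclid R N) :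
  euclid_dot x y = (-1) ^+ false * idfun (euclid_dot y x).
Proof. by rewrite expr0 mul1r; exact: edotC. Qed.

Lemma euclid_dot_gt0 N (u : euclid R N) : u != 0 -> 0 < euclid_dot u u.
Proof.
move=> u0; rewrite lt_def edot_ge0 andbT; apply: contraNN u0 => /eqP h.
by apply/eqP; exact: edot_eq0.
Qed.

Lemma euclid_dot_Dl N (u : euclid R N) : zmod_morphism (@euclid_dot N ^~ u).
Proof. by move=> x y; rewrite /euclid_dot -scaleN1r edotDl edotZl mulN1r. Qed.
Lemma euclid_dot_Dr N (u : euclid R N) : zmod_morphism (@euclid_dot N u).
Proof. by move=> x y; rewrite /euclid_dot -scaleN1r edotDr edotZr mulN1r. Qed.
Lemma euclid_dot_Zl N (u : euclid R N) : scalable_for *%R (@euclid_dot N ^~ u).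
Proof. by move=> a x; rewrite /euclid_dot edotZl. Qed.
Lemma euclid_dot_Zr N (u : euclid R N) : scalable_for (idfun \; *%R) (@euclid_dot N u).
Proof. by move=> a x; rewrite /euclid_dot edotZr. Qed.

HB.instance Definition _ N := isBilinear.Build R (euclid R N) (euclid R N) R
  *%R (idfun \; *%R) (@euclid_dot N) (@euclid_dot_Dl N) (@euclid_dot_Dr N)
  (@euclid_dot_Zl N) (@euclid_dot_Zr N).

HB.instance Definition _ N := isHermitianSesquilinear.Build R (euclid R N)
  false idfun (@euclid_dot N) (@euclid_dot_hermitian N).
HB.instance Definition _ N := isDotProduct.Build R (euclid R N)
  (@euclid_dot N) (@euclid_dot_gt0 N).

End Euclid.

(** * Orthonormal families *)

Section RealDot.
Variables (R : realType) (H : lmodType R) (dot : {dot H for idfun}).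

Lemma dotC x y : dot x y = dot y x.
Proof. by rewrite [LHS]hermitian_subproof expr0 mul1r. Qed.

Lemma dotBl x y z : dot (x - y) z = dot x z - dot y z.
Proof. exact: (zmod_morphisml_subproof z x y). Qed.

Lemma dotZl a x y : dot (a *: x) y = a * dot x y.
Proof. exact: (linearl_subproof y a x). Qed.

Lemma dot0l y : dot 0 y = 0.
Proof. by have := dotBl y y y; rewrite !subrr. Qed.

Lemma dotDl x y z : dot (x + y) z = dot x z + dot y z.
Proof.
by rewrite -[y in LHS]opprK dotBl -(scaleN1r y) dotZl mulN1r opprK.
Qed.

Lemma dotDr x y z : dot z (x + y) = dot z x + dot z y.
Proof. by rewrite dotC dotDl !(dotC z). Qed.

Lemma dotBr x y z : dot z (x - y) = dot z x - dot z y.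
Proof. by rewrite dotC dotBl !(dotC z). Qed.

Lemma dotZr a x y : dot y (a *: x) = a * dot y x.
Proof. by rewrite dotC dotZl dotC. Qed.

Lemma dot0r y : dot y 0 = 0.
Proof. by rewrite dotC dot0l. Qed.

Lemma dotNl x y : dot (- x) y = - dot x y.
Proof. by rewrite -sub0r dotBl dot0l sub0r. Qed.

Lemma dotNr x y : dot x (- y) = - dot x y.
Proof. by rewrite dotC dotNl dotC. Qed.

Lemma dot_suml I (s : seq I) (P : pred I) (F : I -> H) y :
  dot (\sum_(i <- s | P i) F i) y = \sum_(i <- s | P i) dot (F i) y.
Proof. by apply: (big_morph (dot^~ y)) => [u v|]; [exact: dotDl|exact: dot0l]. Qed.

Lemma dot_sumr I (s : seq I) (P : pred I) (F : I -> H) y :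
  dot y (\sum_(i <- s | P i) F i) = \sum_(i <- s | P i) dot y (F i).
Proof. by apply: (big_morph (dot y)) => [u v|]; [exact: dotDr|exact: dot0r]. Qed.

Lemma dot_gt0 u : u != 0 -> 0 < dot u u.
Proof. exact: neq0_dnorm_gt0. Qed.

Lemma dot_ge0 u : 0 <= dot u u.
Proof. by have [->|/dot_gt0/ltW//] := eqVneq u 0; rewrite dot0l. Qed.

Definition orthonormal N (e : nat -> H) : Prop :=
  forall i j, (i < N)%N -> (j < N)%N -> dot (e i) (e j) = (i == j)%:R.

(** Families are indexed by [nat], of which only the first terms matter, so that
    adding a vector does not change the type. The last clause says that [e] lies
    in every linear subspace that contains [v]. *)
Lemma gram_schmidt (v : nat -> H) k : exists N (e : nat -> H),
  [/\ orthonormal N e,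
      forall i, (i < k)%N -> v i = \sum_(j < N) dot (v i) (e j) *: e j &
      forall U : H -> Prop, (forall a x y, U x -> U y -> U (a *: x + y)) ->
        (forall i, (i < k)%N -> U (v i)) -> forall j, (j < N)%N -> U (e j)].
Proof.
elim: k => [|k [N [e [ee ve eU]]]]; first by exists 0%N, (fun=> 0).
pose w := v k - \sum_(j < N) dot (v k) (e j) *: e j.
have we j : (j < N)%N -> dot w (e j) = 0.
  move=> jN; rewrite dotBl dot_suml (bigD1 (Ordinal jN))//= big1 => [|i ij].
    by rewrite dotZl ee// eqxx mulr1 addr0 subrr.
  rewrite dotZl ee//; move: ij; rewrite -val_eqE /= => /negPf->.
  by rewrite mulr0.
have [w0|w0] := eqVneq w 0.
  exists N, e; split=> // [i|U Ulin vU].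
    rewrite ltnS leq_eqVlt => /orP[/eqP->|/ve//].
    by apply/eqP; rewrite -subr_eq0; apply/eqP.
  by apply: eU => // i ik; apply: vU; rewrite ltnS ltnW.
pose a := Num.sqrt (dot w w).
have a0 : a != 0 by rewrite gt_eqF// sqrtr_gt0 dot_gt0.
have aa : dot w w = a * a by rewrite -expr2 sqr_sqrtr// dot_ge0.
pose e' j := if (j < N)%N then e j else a^-1 *: w.
have e'N : e' N = a^-1 *: w by rewrite /e' ltnn.
have e'e (j : nat) : (j < N)%N -> e' j = e j by rewrite /e' => ->.
have we' : dot (v k) (e' N) = a.
  have -> : v k = w + \sum_(j < N) dot (v k) (e j) *: e j by rewrite subrK.
  rewrite e'N dotZr dotDl aa dot_suml big1 ?addr0 ?mulKf// => j _.
  by rewrite dotZl (dotC (e j)) we ?mulr0.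
exists N.+1, e'; split.
- move=> i j; rewrite !ltnS.
  rewrite leq_eqVlt => /orP[/eqP->|iN]; rewrite leq_eqVlt => /orP[/eqP->|jN].
  + by rewrite eqxx e'N dotZl dotZr aa mulKf// mulVf.
  + rewrite e'N e'e// dotZl we// mulr0 gtn_eqF//.
  + by rewrite e'N e'e// dotZr dotC we// mulr0 ltn_eqF//.
  + by rewrite !e'e// ee.
- have e'sum x : \sum_(j < N) dot x (e' j) *: e' j = \sum_(j < N) dot x (e j) *: e j.
    by apply: eq_bigr => j _; rewrite e'e.
  move=> i; rewrite ltnS big_ord_recr /= e'sum leq_eqVlt => /orP[/eqP->|ik].
    by rewrite we' e'N scalerA mulfV// scale1r addrC subrK.
  rewrite -ve// e'N (_ : dot _ _ = 0) ?scale0r ?addr0// ve//.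
  by rewrite dot_suml big1// => j _; rewrite dotZl dotZr (dotC (e j)) we// !mulr0.
- move=> U Ulin vU j.
  have eU' : forall j, (j < N)%N -> U (e j).
    by apply: eU => // i ik; apply: vU; rewrite ltnS ltnW.
  have vk : U (v k) by apply: vU.
  have U0 : U 0 by rewrite -(addNr (v k)) -scaleN1r; apply: (Ulin).
  rewrite ltnS leq_eqVlt => /orP[/eqP->|jN]; last by rewrite e'e//; exact: eU'.
  rewrite e'N -[X in U X]addr0; apply: (Ulin) => //.
  rewrite /w -scaleN1r addrC; apply: (Ulin) => //.
  apply: (big_ind U) => // [x y Ux Uy|i _].
    by rewrite -[x]scale1r; apply: (Ulin).
  by rewrite -[X in U X]addr0; apply: (Ulin) => //; exact: eU'.
Qed.

Lemma orthonormal_norm N e (c : 'I_N -> R) : orthonormal N e ->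
  dot (\sum_j c j *: e j) (\sum_j c j *: e j) = \sum_j c j ^+ 2.
Proof.
move=> ee; rewrite dot_suml; apply: eq_bigr => i _.
rewrite dotZl dot_sumr (bigD1 i)//= big1 => [|j ji].
  by rewrite dotZr ee// eqxx mulr1 addr0 expr2.
by rewrite dotZr ee// val_eqE eq_sym (negPf ji) mulr0.
Qed.

End RealDot.

Section OrthonormalRows.
Variable R : realType.

(** [V^T *m V] is the orthogonal projection onto the row space of [M], and
    right multiplication by [V] embeds l_2^r isometrically onto it. *)
Lemma orthonormal_row_base p N (M : 'M[R]_(p, N)) : exists r (V : 'M[R]_(r, N)),
  [/\ V *m V^T = 1%:M, (V <= M)%MS & M *m V^T *m V = M].
Proof.
pose v (i : nat) : euclid R N := if insub i is Some i' then row i' M else 0.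
have vE (i : 'I_p) : v i = row i M by rewrite /v valK.
have [r [e [ee ve eU]]] := gram_schmidt (@euclid_dot R N) v p.
pose V : 'M[R]_(r, N) := \matrix_j (e j : 'rV[R]_N).
have Vr j : row j V = e j by rewrite rowK.
exists r, V; split.
- by apply/matrixP => i j; rewrite gram_entry !Vr [RHS]mxE; exact: ee.
- apply/row_subP => j; rewrite Vr; apply: (eU (fun x => (x : 'rV_N) <= M)%MS) => //.
    by move=> a x y xM yM; rewrite addmx_sub// scalemx_sub.
  by move=> i ip; rewrite (vE (Ordinal ip)) row_sub.
- apply/row_matrixP => i; rewrite -vE (ve _ (ltn_ord i)) row_mul mulmx_sum_row.
  by apply: eq_bigr => j _; rewrite Vr vE mxE gram_entry Vr.
Qed.

End OrthonormalRows.

(** * Gauges, operator norms and upper bounds for omega_2 *)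

Section Norms.
Variable R : realType.
Implicit Types E H : vectType R.

Definition homogeneous (V : lmodType R) (p : V -> \bar R) : Prop :=
  p 0 = 0%E /\ forall (a : R) x, 0 < a -> (p (a *: x) = a%:E * p x)%E.

Lemma linf_homogeneous d : homogeneous (@linf_norm R d).
Proof.
split=> [|a x a0]; first by rewrite /linf_norm normr0.
by rewrite /linf_norm normrZ gtr0_norm.
Qed.

Lemma gauge_ge0 (V : lmodType R) (P : set V) x : (0 <= gauge_fun P x)%E.
Proof. by apply: le_ereal_inf_tmp => _ [l [l0 _] <-]; rewrite lee_fin ltW. Qed.

Lemma gauge_le (V : lmodType R) (P : set V) x l :
  0 < l -> P (l^-1 *: x) -> (gauge_fun P x <= l%:E)%E.
Proof. by move=> l0 Px; apply: ereal_inf_lbound; exists l. Qed.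

Lemma gauge_homogeneous (V : lmodType R) (P : set V) : P 0 ->
  homogeneous (gauge_fun P).
Proof.
move=> P0; split=> [|a x a0].
  apply/eqP; rewrite eq_le gauge_ge0 andbT; apply/lee_addgt0Pr => e e0.
  by rewrite add0e gauge_le// scaler0.
have sub b y : 0 < b -> (gauge_fun P (b *: y) <= b%:E * gauge_fun P y)%E.
  move=> b0; rewrite muleC -lee_pdivrMr//; apply: le_ereal_inf_tmp => _ [l [l0 Pl] <-].
  rewrite lee_pdivrMr// -EFinM gauge_le ?mulr_gt0// invfM scalerA.
  by rewrite -mulrA mulVf ?mulr1// gt_eqF.
apply/eqP; rewrite eq_le sub//= -lee_pdivlMl//.
rewrite -[x in leLHS](scalerK (lt0r_neq0 a0)).
by apply: sub; rewrite invr_gt0.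
Qed.

Lemma opnorm_ge0 (V W : lmodType R) D (p : V -> \bar R) (q : W -> \bar R)
    (f : V -> W) v : D v -> (p v <= 1)%E -> (0 <= q (f v))%E ->
  (0 <= opnorm D p q f)%E.
Proof.
by move=> Dv pv qv; apply: (le_trans qv); apply: ereal_sup_ubound; exists v.
Qed.

Lemma opnorm_unit (V W : lmodType R) (D : set V) (p : V -> \bar R) (q : W -> \bar R)
    (f : V -> W) v : D v -> (p v <= 1)%E -> (q (f v) <= opnorm D p q f)%E.
Proof. by move=> Dv pv; apply: ereal_sup_ubound; exists v. Qed.

(** Scaling [v] by [c'^-1] for [c' > c] avoids dividing by [c], which may be
    0. *)
Lemma opnorm_bound (V W : lmodType R) (D : set V) (p : V -> \bar R)
    (q : W -> \bar R) (f : {linear V -> W}) (K c : R) v :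
  homogeneous p -> homogeneous q -> (forall a : R, D v -> D (a *: v)) ->
  (opnorm D p q f <= K%:E)%E -> 0 <= K -> 0 <= c ->
  D v -> (p v <= c%:E)%E -> (q (f v) <= (K * c)%:E)%E.
Proof.
move=> [p0 pZ] [q0 qZ] DZ fK K0 c0 Dv pvc.
have main c' : 0 < c' -> c <= c' -> (q (f v) <= (K * c')%:E)%E.
  move=> c'0 cc'; have c'V : 0 < c'^-1 by rewrite invr_gt0.
  rewrite -[v](scalerKV (lt0r_neq0 c'0)) linearZ qZ// EFinM muleC lee_pmul2r//.
  apply: le_trans fK; apply: opnorm_unit; first exact: DZ.
  by rewrite pZ// lee_pdivrMl// mule1 (le_trans pvc)// lee_fin.
have [K00|K00] := eqVneq K 0.
  by have := main (c + 1); rewrite K00 !mul0r; apply; [exact: ltr_wpDl|rewrite lerDl].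
have Kp : 0 < K by rewrite lt_def K00.
apply/lee_addgt0Pr => e e0; rewrite -EFinD.
have := main (c + e / K); rewrite mulrDr (mulrC K (e / K)) mulfVK//; apply.
  by rewrite ltr_wpDl// divr_gt0.
by rewrite lerDl divr_ge0// ltW.
Qed.

Lemma dual_norm_bound (E : vectType R) (p : E -> \bar R) (f : dual E) c v :
  homogeneous p -> (dual_norm p f <= 1)%E -> 0 <= c -> (p v <= c%:E)%E ->
  `|f v : R| <= c.
Proof.
move=> hp f1 c0 pv; rewrite -lee_fin -[c]mul1r.
apply: (opnorm_bound (D := setT) (q := fun r : R^o => `|r|%:E) hp _ _ f1) => //.
split=> [|a x a0]; first by rewrite normr0.
by rewrite normrM gtr0_norm.
Qed.

Lemma dual_norm0 (E : vectType R) (p : E -> \bar R) : (dual_norm p (0%R : dual E) <= 1)%E.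
Proof.
by apply: ge_ereal_sup => _ [x _ <-]; rewrite zero_lfunE normr0 lee_fin.
Qed.

Definition lincomb (V : lmodType R) N (x : 'I_N -> V) (h : 'rV[R]_N) : V :=
  \sum_k h 0 k *: x k.

(** The operator of [z] factors as [S] followed by [lincomb y], where
    [S f] has coordinates [f (x k)] and is the adjoint of [lincomb x]. Its norm
    is estimated by evaluating [f] at [lincomb x (S f)], where [f] takes the
    value [enorm (S f) ^+ 2]; no bidual is involved. *)
Lemma omega2_le (E1 E2 T : vectType R) (t : {bilinear E1 -> E2 -> T})
    (p : E1 -> \bar R) (q : E2 -> \bar R) N (x : 'I_N -> E1) (y : 'I_N -> E2)
    (z : T) (c1 c2 : R) :
  z = \sum_k t (x k) (y k) ->
  homogeneous p -> (forall v, 0 <= q v)%E -> 0 <= c1 -> 0 <= c2 ->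
  (forall h : 'rV[R]_N, p (lincomb x h) <= (c1 * enorm h)%:E)%E ->
  (forall h : 'rV[R]_N, q (lincomb y h) <= (c2 * enorm h)%:E)%E ->
  (omega2 t p q z <= (c1 * c2)%:E)%E.
Proof.
move=> zE hp q0 c10 c20 px qy.
pose S0 (f : dual E1) : euclid R N := \row_k (f (x k) : R).
pose Q0 (h : euclid R N) : E2 := \sum_k (h : 'rV[R]_N) 0 k *: y k.
have S0_lin : linear S0.
  by move=> a f g; apply/rowP => k; rewrite !mxE !lfunE /= lfunE.
have Q0_lin : linear Q0.
  move=> a h g; rewrite /Q0 scaler_sumr -big_split; apply: eq_bigr => k _ /=.
  by rewrite !mxE scalerDl scalerA.
pose SL := GRing.isLinear.Build R (dual E1) (euclid R N) *:%R S0 S0_lin.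
pose S : {linear dual E1 -> euclid R N} := HB.pack S0 SL.
pose QL := GRing.isLinear.Build R (euclid R N) E2 *:%R Q0 Q0_lin.
pose Q : {linear euclid R N -> E2} := HB.pack Q0 QL.
pose nH := fun h : euclid R N => `|h|%:E.
have nS : (opnorm setT (dual_norm p) nH S <= c1%:E)%E.
  apply: ge_ereal_sup => _ [f [_ f1] <-]; rewrite /nH lee_fin euclid_normE.
  set h := S f; have [->|h0] := eqVneq (enorm h) 0; first by [].
  have hp0 : 0 < enorm h by rewrite lt_def h0 enorm_ge0.
  have c0 : 0 <= c1 * enorm h by rewrite mulr_ge0// enorm_ge0.
  have := dual_norm_bound hp f1 c0 (px h).
  rewrite linear_sum (eq_bigr (fun k => h 0 k * h 0 k)) -?edotE; last first.
    by move=> k _; rewrite linearZ [X in _ = _ * X]mxE.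
  by rewrite ger0_norm ?edot_ge0// -enorm_sqr expr2 ler_pM2r.
have nQ : (opnorm setT nH q Q <= c2%:E)%E.
  apply: ge_ereal_sup => _ [h [_ h1] <-]; apply: (le_trans (qy h)).
  by rewrite lee_fin -[leRHS]mulr1 ler_wpM2l.
have nS0 : (0 <= opnorm setT (dual_norm p) nH S)%E.
  by apply: (opnorm_ge0 (v := 0)) => //; [exact: dual_norm0 | rewrite lee_fin].
have nQ0 : (0 <= opnorm setT nH q Q)%E.
  by apply: (opnorm_ge0 (v := 0)) => //; rewrite /nH normr0 lee_fin.
rewrite [c1 * c2]mulrC EFinM.
apply: (@le_trans _ _ (opnorm setT nH q Q * opnorm setT (dual_norm p) nH S)%E);
  last exact: lee_pmul.
apply: ereal_inf_lbound; exists (euclid R N), (@euclid_dot R N), S, Q; split=> //.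
- exists N, x, y; split=> // f; rewrite /= /Q0 /S0.
  by apply: eq_bigr => k _; rewrite mxE.
- exact: le_lt_trans nS (ltry _).
- exact: le_lt_trans nQ (ltry _).
Qed.

End Norms.

(** * The Grothendieck constant *)

Section GrothendieckConstant.
Variable R : realType.

Lemma omega2_ge0 (E1 E2 T : vectType R) (t : {bilinear E1 -> E2 -> T})
    (p : E1 -> \bar R) (q : E2 -> \bar R) (z : T) :
  (forall v, 0 <= q v)%E -> (0 <= omega2 t p q z)%E.
Proof.
move=> q0; apply: le_ereal_inf_tmp => _ [H [dot [S [Q [_ _ _ _ ->]]]]].
apply: mule_ge0.
  by apply: (opnorm_ge0 (v := 0)) => //; rewrite normr0 lee_fin.
by apply: (opnorm_ge0 (v := 0)) => //; exact: dual_norm0.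
Qed.

(** Evaluating the factorization on coordinate functionals [phi i] writes
    [u i j] as an inner product of [S (phi i)] with the vector representing the
    [j]-th coordinate of [Q]. Only the span of the [S (phi i)] matters, and it
    is identified with l_2^N by an orthonormal basis, which also replaces
    the Riesz representation of the coordinates of [Q]. *)
Lemma pi_le_hilbert m n (u : 'M[R]_(m, n)) (H : completeNormedModType R)
    (dot : {dot H for idfun}) (S : {linear dual 'rV[R]_m -> H})
    (Q : {linear H -> 'rV[R]_n}) r s :
  (forall h, `|h| = Num.sqrt (dot h h)) ->
  tensor_operator (@mx_tens R m n) u (Q \o S) ->
  opnorm setT (dual_norm (@linf_norm R m)) (fun h : H => `|h|%:E) S = r%:E ->
  opnorm setT (fun h : H => `|h|%:E) (@linf_norm R n) Q = s%:E ->
  pi_le u (99 * r * s).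
Proof.
move=> normE [k [x [y [uE QSE]]]] Sr Qs.
have nH : homogeneous (fun h : H => `|h|%:E).
  by split=> [|a h a0]; [rewrite normr0|rewrite normrZ gtr0_norm].
have r0 : 0 <= r.
  rewrite -lee_fin -Sr; apply: (opnorm_ge0 (v := 0)) => //; exact: dual_norm0.
have s0 : 0 <= s.
  rewrite -lee_fin -Qs; apply: (opnorm_ge0 (v := 0)) => //; rewrite lee_fin//.
  by rewrite normr0.
have normsq h : `|h| ^+ 2 = dot h h by rewrite normE sqr_sqrtr// dot_ge0.
pose phi0 (i : 'I_m) (v : 'rV[R]_m) : R^o := v 0 i.
have phi0_lin i : linear (phi0 i) by move=> a v w; rewrite /phi0 !mxE.
pose phiL i := GRing.isLinear.Build R 'rV[R]_m R^o *:%R (phi0 i) (phi0_lin i).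
pose phi i : dual 'rV[R]_m := linfun (HB.pack (phi0 i) (phiL i) : {linear _ -> _}).
have phiE i v : phi i v = v 0 i by rewrite lfunE.
pose v (i : nat) : H := if insub i is Some i' then S (phi i') else 0.
have vE (i : 'I_m) : v i = S (phi i) by rewrite /v valK.
have [N [e [ee ve _]]] := gram_schmidt dot v m.
pose A : 'M[R]_(m, N) := \matrix_(i, l) dot (S (phi i)) (e l).
pose B : 'M[R]_(n, N) := \matrix_(j, l) Q (e l) 0 j.
have Sphi i : S (phi i) = \sum_l A i l *: e l.
  rewrite -vE (ve _ (ltn_ord i)); apply: eq_bigr => l _.
  by rewrite mxE vE.
have -> : u = A *m B^T.
  apply/matrixP => i j; have := QSE (phi i); rewrite /= Sphi linear_sum => /rowP/(_ j).
  rewrite !summxE uE summxE => h.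
  rewrite mxE (eq_bigr (fun l => (Q (A i l *: e l)) 0 j)); last first.
    by move=> l _; rewrite linearZ [RHS]mxE [X in _ * X = _]mxE [X in _ * X = _]mxE.
  rewrite h; apply: eq_bigr => l _.
  by rewrite !mxE big_ord1 !mxE phiE.
apply: grothendieck_gram => // i.
- rewrite (_ : edot _ _ = dot (S (phi i)) (S (phi i))); last first.
    rewrite Sphi orthonormal_norm// edotE; apply: eq_bigr => l _.
    by rewrite !mxE expr2.
  rewrite -normsq ler_sqr ?nnegrE// -lee_fin -Sr.
  apply: (@opnorm_unit R _ _ setT _ (fun h : H => `|h|%:E) S) => //.
  apply: ge_ereal_sup => _ [w [_ w1] <-]; rewrite lee_fin phiE.
  by apply: le_trans (row_entry_le w i) _; rewrite -lee_fin.
- set b := row i B; pose h := \sum_l b 0 l *: e l.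
  have hh : dot h h = edot b b.
    by rewrite orthonormal_norm// edotE; apply: eq_bigr => l _; rewrite expr2.
  have Qh : (Q h) 0 i = edot b b.
    rewrite linear_sum summxE edotE; apply: eq_bigr => l _.
    by rewrite linearZ mxE [X in _ = _ * X]mxE [X in _ = _ * X]mxE.
  have : `|edot b b| <= s * `|h|.
    rewrite -Qh; apply: le_trans (row_entry_le _ _) _.
    have := @opnorm_bound R H _ setT _ _ Q s `|h| h nH (linf_homogeneous _ _).
    by rewrite Qs lee_fin; apply.
  rewrite -hh -normsq ger0_norm ?sqr_ge0// => hs.
  have [->|h0] := eqVneq `|h| 0; first by rewrite expr0n sqr_ge0.
  rewrite ler_sqr ?nnegrE//; move: hs; rewrite expr2 ler_pM2r//.
  by rewrite lt_def h0 /=.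
Qed.

Lemma grothendieck_99 m n (u : 'M[R]_(m, n)) :
  (pi_norm (@mx_tens R m n) (@linf_norm R m) (@linf_norm R n) u <=
   99%:E * omega2 (@mx_tens R m n) (@linf_norm R m) (@linf_norm R n) u)%E.
Proof.
rewrite -lee_pdivrMl//; apply: le_ereal_inf_tmp.
move=> _ [H [dot [S [Q [nH tu fS fQ ->]]]]].
have S0 : (0 <= opnorm setT (dual_norm (@linf_norm R m)) (fun h : H => `|h|%:E) S)%E.
  by apply: (opnorm_ge0 (v := 0)) => //; exact: dual_norm0.
have Q0 : (0 <= opnorm setT (fun h : H => `|h|%:E) (@linf_norm R n) Q)%E.
  apply: (opnorm_ge0 (v := 0)) => //; rewrite lee_fin//.
  by rewrite normr0.
rewrite lee_pdivrMl//.
move: fS fQ; rewrite -!ge0_fin_numE// => /fineK Sr /fineK Qs.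
apply: le_trans (pi_le_norm (pi_le_hilbert nH tu (esym Sr) (esym Qs))) _.
rewrite -[in leRHS]Sr -[in leRHS]Qs -!EFinM lee_fin.
by rewrite -mulrA [leRHS]mulrA mulrAC -mulrA.
Qed.

(** The set whose infimum is [grothendieck_constant]. *)
Definition grothendieck_bounds : set R := [set K : R | forall m n (u : 'M[R]_(m, n)),
    (pi_norm (@mx_tens R m n) (@linf_norm R m) (@linf_norm R n) u <=
     K%:E * omega2 (@mx_tens R m n) (@linf_norm R m) (@linf_norm R n) u)%E].

(** Tested on the [1 x 1] matrix with entry 1. *)
Lemma grothendieck_bounds_ge1 : lbound grothendieck_bounds 1.
Proof.
move=> K hK; have := hK 1%N 1%N (const_mx 1).
set w := omega2 _ _ _ _; set p := pi_norm _ _ _ _ => pw.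
have n1 : `|const_mx 1 : 'rV[R]_1| <= 1.
  by apply: row_norm_le => // i; rewrite mxE normr1.
have p1 : (1 <= p)%E.
  apply: le_ereal_inf_tmp => _ [n [x [y [/matrixP/(_ 0 0) uE ->]]]].
  rewrite sumEFin lee_fin; move: uE; rewrite mxE summxE => ->.
  apply: ler_sum => k _; rewrite mxE big_ord1 mxE.
  apply: (le_trans (ler_norm _)); rewrite normrM.
  by apply: ler_pM => //; exact: row_entry_le.
have w1 : (w <= 1)%E.
  rewrite -[1%E]mule1; apply: (@omega2_le R _ _ _ _ _ _ 1%N (fun=> const_mx 1)
     (fun=> const_mx 1)) => //.
  - rewrite big_ord1; apply/matrixP => i j.
    by rewrite [LHS]mxE [RHS]mxE big_ord1 !mxE mulr1.
  - exact: linf_homogeneous.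
  - by move=> v; rewrite lee_fin.
  - move=> h; rewrite lee_fin mul1r /lincomb big_ord1 normrZ.
    apply: le_trans (entry_le_enorm h 0); rewrite -[leRHS]mulr1.
    exact: ler_wpM2l.
  - move=> h; rewrite lee_fin mul1r /lincomb big_ord1 normrZ.
    apply: le_trans (entry_le_enorm h 0); rewrite -[leRHS]mulr1.
    exact: ler_wpM2l.
have w0 : (0 <= w)%E by apply: omega2_ge0 => v; rewrite lee_fin.
rewrite leNgt; apply/negP => K1.
have [K0|K0] := leP 0 K.
  have : (1 <= K%:E)%E.
    apply: (le_trans p1); apply: (le_trans pw); rewrite -[leRHS]mule1.
    exact: lee_wpmul2l.
  by rewrite lee_fin leNgt K1.
have : (1 <= 0 :> \bar R)%E.
  apply: (le_trans p1); apply: (le_trans pw).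
  by apply: mule_le0_ge0 => //; rewrite lee_fin ltW.
by rewrite lee_fin ler10.
Qed.

Lemma grothendieck_constant_ge1 : 1 <= grothendieck_constant R.
Proof.
apply: lb_le_inf; last exact: grothendieck_bounds_ge1.
by exists 99; exact: grothendieck_99.
Qed.

(** For a fixed matrix the condition on [K] is closed, so the infimum of the
    admissible constants is admissible. *)
Lemma grothendieck_inequality : grothendieck_bounds (grothendieck_constant R).
Proof.
move=> m n u; have hK K (KB : grothendieck_bounds K) := KB m n u.
move: hK; set w := omega2 _ _ _ _; set p := pi_norm _ _ _ _ => hK.
have w0 : (0 <= w)%E by apply: omega2_ge0 => v; rewrite lee_fin.
have KG0 : 0 < grothendieck_constant R.
  exact: lt_le_trans grothendieck_constant_ge1.
have p99 : (p <= 99%:E * w)%E by apply: hK; exact: grothendieck_99.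
case: w w0 hK p99 => [w| |] //= w0 hK p99; last by rewrite gt0_muley ?leey ?lte_fin.
have [w00|wN0] := eqVneq w 0; first by move: p99; rewrite w00 !mule0.
have wp : 0 < w by rewrite lt_def wN0 -lee_fin.
rewrite -lee_pdivrMr//.
have : (forall K, grothendieck_bounds K -> p * w^-1%:E <= K%:E)%E.
  by move=> K /hK; rewrite lee_pdivrMr.
case: (p * w^-1%:E)%E => [c| |] h; last by rewrite leNye.
  rewrite lee_fin; apply: lb_le_inf; first by exists 99; exact: grothendieck_99.
  by move=> K /h; rewrite lee_fin.
by have := h 99 grothendieck_99.
Qed.

End GrothendieckConstant.

(** * The projective unit ball of l_oo *)

Section Convexity.
Variables (R : realType) (V : lmodType R).
Implicit Types A : set V.

Lemma convex_comb A (l : R) x y : convex_set (A : set (convex_lmodType V)) ->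
  0 <= l <= 1 -> A x -> A y -> A (l *: x + (1 - l) *: y).
Proof.
move=> cA /andP[l0 l1] /mem_set Ax /mem_set Ay.
by have := cA x y (Itv01 l0 l1) Ax Ay; rewrite inE.
Qed.

Lemma convex_setI A :
  (forall (l : R) x y, 0 <= l <= 1 -> A x -> A y -> A (l *: x + (1 - l) *: y)) ->
  convex_set (A : set (convex_lmodType V)).
Proof.
move=> h x y l; rewrite !inE => Ax Ay; apply: h => //.
by apply/andP; split.
Qed.

Lemma convex_hull_convex A : convex_set (convex_hull A : set (convex_lmodType V)).
Proof.
apply: convex_setI => l x y l01 Ax Ay B [cB AB].
by apply: convex_comb => //; [exact: Ax|exact: Ay].
Qed.

(** The induction needs the statement for all total weights [c], since removing
    a term changes the total. *)
Lemma convex_sum A I (s : seq I) (mu : I -> R) (v : I -> V) :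
  convex_set (A : set (convex_lmodType V)) -> A 0 ->
  (forall i, A (v i)) -> (forall i, 0 <= mu i) -> \sum_(i <- s) mu i <= 1 ->
  A (\sum_(i <- s) mu i *: v i).
Proof.
move=> cA A0 Av mu0 mu1.
suff h c : 0 < c -> \sum_(i <- s) mu i <= c -> A (c^-1 *: \sum_(i <- s) mu i *: v i).
  by have := h 1 ltr01 mu1; rewrite invr1 scale1r.
move=> c0; elim: s c c0 {mu1} => [|i s ih] c c0.
  by rewrite !big_nil scaler0.
rewrite !big_cons => sc.
have mi := mu0 i.
have s0 : 0 <= \sum_(j <- s) mu j by apply: sumr_ge0.
have l01 : 0 <= mu i / c <= 1.
  by rewrite divr_ge0// ?(ltW c0)//= ler_pdivrMr// mul1r; lra.
have lE : 1 - mu i / c = (c - mu i) / c by rewrite mulrBl mulfV ?gt_eqF.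
have [c'0|c'0] := eqVneq (c - mu i) 0.
  have sm0 : \sum_(j <- s) mu j = 0 by lra.
  have : A (mu i / c *: v i + (1 - mu i / c) *: 0) by apply: convex_comb.
  have -> : \sum_(j <- s) mu j *: v j = 0.
    elim: s sm0 {ih s0 sc} => [|j s ih]; first by rewrite !big_nil.
    have sj : 0 <= \sum_(k <- s) mu k by apply: sumr_ge0.
    have mj := mu0 j.
    rewrite !big_cons => jz; rewrite ih ?addr0; last by lra.
    by rewrite (_ : mu j = 0) ?scale0r//; lra.
  by rewrite scaler0 !addr0 scalerA mulrC.
have c'p : 0 < c - mu i by rewrite lt_def c'0; lra.
have := convex_comb cA l01 (Av i) (ih _ c'p _).
rewrite lE scalerA mulrAC mulfV// mul1r scalerDr scalerA [c^-1 * _]mulrC; apply.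
lra.
Qed.

End Convexity.

Section SignTensors.
Variable R : realType.

Definition sign_row d (e : {ffun 'I_d -> bool}) : 'rV[R]_d := \row_i (-1) ^+ e i.

Lemma sign_row_norm d (e : {ffun 'I_d -> bool}) : `|sign_row e| <= 1.
Proof. by apply: row_norm_le => // i; rewrite mxE normrX normrN1 expr1n. Qed.

(** [mu] is the law of independent signs with means [x 0 i], whose expectation is
    [x]. *)
Lemma sign_decomposition d (x : 'rV[R]_d) : `|x| <= 1 ->
  exists mu : {ffun 'I_d -> bool} -> R, [/\ forall e, 0 <= mu e,
    \sum_e mu e = 1 & x = \sum_e mu e *: sign_row e].
Proof.
move=> x1; pose F i (b : bool) : R := (1 + (-1) ^+ b * x 0 i) / 2.
have F0 i b : 0 <= F i b.
  have := le_trans (row_entry_le x i) x1; rewrite ler_norml /F => /andP[h1 h2].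
  by apply: divr_ge0 => //; case: b; rewrite ?expr1 ?expr0; lra.
have F1 i : \sum_b F i b = 1 by rewrite big_bool /F /= expr1 expr0; field.
exists (fun e => \prod_i F i (e i)); split.
- by move=> e; apply: prodr_ge0.
- by rewrite -(bigA_distr_bigA F) big1.
apply/rowP => j; rewrite summxE.
pose G i b : R := F i b * (if i == j then (-1) ^+ b else 1).
rewrite (eq_bigr (fun e : {ffun 'I_d -> bool} => \prod_i G i (e i))).
  rewrite -(bigA_distr_bigA G) (bigD1 j)//= [X in _ * X]big1 => [|i ij].
    by rewrite mulr1 big_bool /G eqxx /F /= expr1 expr0; field.
  by rewrite -[RHS](F1 i); apply: eq_bigr => b _; rewrite /G (negPf ij) mulr1.
move=> e _; rewrite !mxE /G [RHS]big_split /=; congr (_ * _).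
by rewrite -big_mkcond big_pred1_eq.
Qed.

Section Polytope.
Variables m n : nat.
Let I : finType := ({ffun 'I_m -> bool} * {ffun 'I_n -> bool})%type.
(** The polytope spanned by tensors of sign vectors, parametrized by the compact
    set of weights of total mass at most 1. *)
Let vert (i : I) : 'M[R]_(m, n) := mx_tens (sign_row i.1) (sign_row i.2).
Let L (l : 'rV[R]_#|I|) : 'M[R]_(m, n) := \sum_k l 0 k *: vert (enum_val k).
Let simplex : set 'rV[R]_#|I| :=
  [set l | (forall k, `[0, 1]%classic (l 0 k)) /\ \sum_k l 0 k <= 1].

Let body := pi_body (@mx_tens R m n) (@linf_ball R m) (@linf_ball R n).

Lemma pi_body_tens (x : 'rV[R]_m) (y : 'rV[R]_n) : `|x| <= 1 -> `|y| <= 1 ->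
  body (mx_tens x y).
Proof. by move=> x1 y1; apply: sub_gen_smallest; exists (x, y). Qed.

Lemma mx_tens0l (y : 'rV[R]_n) : mx_tens (0 : 'rV[R]_m) y = 0.
Proof. by rewrite /mx_tens trmx0 mul0mx. Qed.

Lemma mx_tensZ a b (x : 'rV[R]_m) (y : 'rV[R]_n) :
  mx_tens (a *: x) (b *: y) = (a * b) *: mx_tens x y.
Proof.
by rewrite /mx_tens [X in X *m _]linearZ /= -scalemxAl -scalemxAr scalerA.
Qed.

Lemma pi_body0 : body 0.
Proof. by rewrite -(mx_tens0l 0); apply: pi_body_tens; rewrite normr0. Qed.

Let simplex_body l : simplex l -> body (L l).
Proof.
move=> [l0 l1]; apply: convex_sum => //.
- exact: convex_hull_convex.
- exact: pi_body0.
- by move=> k; apply: pi_body_tens; exact: sign_row_norm.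
- by move=> k; have := l0 k; rewrite /= in_itv /= => /andP[].
Qed.

Let simplex_image := [set w | exists2 l, simplex l & w = L l].

Let image_convex : convex_set (simplex_image : set (convex_lmodType 'M[R]_(m, n))).
Proof.
apply: convex_setI => a _ _ a01 [l [l0 l1] ->] [k [k0 k1] ->].
have a01' := a01; case/andP: a01' => a0 a1.
exists (a *: l + (1 - a) *: k).
  split=> [i|].
    have := l0 i; have := k0 i; rewrite /= !in_itv /= !mxE.
    by move=> /andP[k00 k11] /andP[l00 l11]; apply/andP; split; nra.
  rewrite (eq_bigr (fun i => a * l 0 i + (1 - a) * k 0 i)); last first.
    by move=> i _; rewrite !mxE.
  by rewrite big_split /= -!mulr_sumr; nra.
rewrite /L !scaler_sumr -big_split; apply: eq_bigr => i _ /=.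
by rewrite !mxE [RHS]scalerDl !scalerA.
Qed.

Let image0 : simplex_image 0.
Proof.
exists 0; last by rewrite /L big1// => k _; rewrite mxE scale0r.
split; last by rewrite big1// => k _; rewrite mxE.
by move=> k; rewrite /= mxE in_itv /= lexx ler01.
Qed.

Let image_vert i : simplex_image (vert i).
Proof.
exists (delta_mx 0 (enum_rank i)).
  split=> [k|].
    by rewrite /= in_itv /= !mxE eqxx /=; case: eqP; rewrite /= ?lexx ?ler01.
  rewrite (bigD1 (enum_rank i))//= big1 => [|k ki].
    by rewrite mxE !eqxx addr0.
  by rewrite mxE (negPf ki) andbF.
rewrite /L (bigD1 (enum_rank i))//= big1 => [|k ki].
  by rewrite mxE !eqxx scale1r addr0 enum_rankK.
by rewrite mxE (negPf ki) andbF scale0r.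
Qed.

Let image_tens (x : 'rV[R]_m) (y : 'rV[R]_n) : `|x| <= 1 -> `|y| <= 1 ->
  simplex_image (mx_tens x y).
Proof.
move=> /sign_decomposition[mu [mu0 mu1 ->]] /sign_decomposition[nu [nu0 nu1 ->]].
rewrite /mx_tens [X in X *m _]linear_sum mulmx_suml.
rewrite (eq_bigr (fun e => mu e *: ((sign_row e)^T *m \sum_d nu d *: sign_row d))).
  apply: convex_sum; rewrite ?mu1// => e.
  rewrite mulmx_sumr (eq_bigr (fun d => nu d *: vert (e, d))).
    by apply: convex_sum; rewrite ?nu1.
  by move=> d _; rewrite -scalemxAr.
by move=> e _; rewrite linearZ /= -scalemxAl.
Qed.

Lemma pi_le_image (w : 'M[R]_(m, n)) c : 0 < c -> pi_le w c ->
  simplex_image (c^-1 *: w).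
Proof.
move=> c0 [k [x [y [-> xyc]]]].
rewrite scaler_sumr (eq_bigr (fun i => (c^-1 * (`|x i| * `|y i|)) *:
    mx_tens (`|x i|^-1 *: x i) (`|y i|^-1 *: y i))).
  have norm_unit d (v : 'rV[R]_d) : `| `|v|^-1 *: v| <= 1.
    have [->|v0] := eqVneq v 0; first by rewrite scaler0 normr0.
    by rewrite normfZV.
  apply: convex_sum => [||i|i|].
  - exact: image_convex.
  - exact: image0.
  - by apply: image_tens; exact: norm_unit.
  - by apply: mulr_ge0; [rewrite invr_ge0 ltW|rewrite mulr_ge0].
  - by rewrite -mulr_sumr mulrC ler_pdivrMr// mul1r.
move=> i _; rewrite mx_tensZ scalerA.
have [->|x0] := eqVneq (x i) 0; first by rewrite mx_tens0l !scaler0.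
have [->|y0] := eqVneq (y i) 0; first by rewrite /mx_tens mulmx0 !scaler0.
congr (_ *: _); field; rewrite !normr_eq0 x0 y0 /=.
by rewrite gt_eqF.
Qed.

Let simplex_compact : compact simplex.
Proof.
rewrite (_ : simplex = [set l | forall k, `[0, 1]%classic (l 0 k)] `&`
   [set l | \sum_k l 0 k <= 1]); last by [].
apply: compact_closedI.
  have := @rV_compact R #|I| (fun=> `[0, 1]%classic) (fun=> @segment_compact R 0 1). exact.
apply: (@preimage_closed _ _ (fun l : 'rV[R]_#|I| => \sum_k l 0 k) [set x | x <= 1]);
  last exact: closed_le.
move=> l _; apply: continuous_big => [|k _]; first exact: add_continuous.
exact: coord_continuous.
Qed.

Let L_continuous : continuous L.
Proof.
apply: continuous_big => [|k _ l]; first exact: add_continuous.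
by apply: cvgZr_tmp; [exact: nbhs_filter|exact: (@coord_continuous R 1 _ 0 k l)].
Qed.

(** The bound on [pi] gives points of the polytope as close to [w] as desired;
    the distance to [w] attains its minimum on the compact set of weights, so
    this minimum is 0. *)
Lemma pi_norm_le1_body (w : 'M[R]_(m, n)) :
  (pi_norm (@mx_tens R m n) (@linf_norm R m) (@linf_norm R n) w <= 1)%E -> body w.
Proof.
move=> w1.
have [c cS cmin] : exists2 c, c \in simplex &
    forall l, l \in simplex -> `|w - L c| <= `|w - L l|.
  apply: compact_EVT_min.
  - by have [l ls _] := image0; exists l.
  - exact: simplex_compact.
  - apply: continuous_subspaceT => l; apply: cvg_norm; first exact: nbhs_filter.
    exact: (cvgB (cvg_cst w) (@L_continuous l)).
suff -> : w = L c by apply: simplex_body; rewrite inE in cS.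
apply/eqP; rewrite -subr_eq0 -normr_eq0 eq_le normr_ge0 andbT leNgt.
apply/negP; set e := `|_| => e0.
(* [w] is at distance less than [a * `|w|] from [(1 + a)^-1 *: w], and [a] is
   chosen to make this smaller than [e]. *)
pose a := e / (2 * (1 + `|w|)).
have w0 : 0 <= `|w| by [].
have a0 : 0 < a by rewrite divr_gt0// mulr_gt0//; lra.
have aw : a * `|w| < e.
  rewrite /a mulrAC ltr_pdivrMr; first nra.
  by rewrite mulr_gt0//; lra.
have [_ [k [x [y [wE ->]]]] xy] : exists2 r,
    [set c | exists k (x : 'I_k -> 'rV[R]_m) (y : 'I_k -> 'rV[R]_n),
      w = \sum_i mx_tens (x i) (y i) /\
      c = (\sum_i (@linf_norm R m (x i) * @linf_norm R n (y i)))%E] r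
    & (r < (1 + a)%:E)%E.
  by apply: ereal_inf_lt; apply: le_lt_trans w1 _; rewrite lte_fin; lra.
have wa : pi_le w (1 + a).
  exists k, x, y; split=> //; move: xy; rewrite /linf_norm.
  by rewrite sumEFin lte_fin => /ltW.
have a10 : 0 < 1 + a by lra.
have [l ls lw] := pi_le_image a10 wa.
have := cmin l (mem_set ls); rewrite -/e -lw leNgt; case/negP.
rewrite -[w in w - _]scale1r -scalerBl normrZ.
apply: le_lt_trans aw; apply: ler_wpM2r => //.
rewrite ger0_norm; last by rewrite subr_ge0 invf_le1//; lra.
rewrite -(ler_pM2r a10) mulrBl mulVf ?gt_eqF//; nra.
Qed.

End Polytope.
End SignTensors.

(** * Tensors represented by contractions from l_2 *)

Section HilbertRepresentation.
Variable R : realType.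

(** [h |-> h *m X] is a contraction from l_2^N to l_oo^m. *)
Definition short_rows N m (X : 'M[R]_(N, m)) : Prop :=
  forall h : 'rV[R]_N, `|h *m X| <= enorm h.

Definition hilbert_rep m n (w : 'M[R]_(m, n)) : Prop :=
  exists N (X : 'M[R]_(N, m)) (Y : 'M[R]_(N, n)),
    [/\ w = X^T *m Y, short_rows X & short_rows Y].

Lemma short_rows1 m (x : 'rV[R]_m) : `|x| <= 1 -> short_rows x.
Proof.
move=> x1 h; have -> : h *m x = h 0 0 *: x.
  by apply/rowP => i; rewrite mxE big_ord1 mxE.
rewrite normrZ; apply: le_trans (entry_le_enorm h 0); rewrite -[leRHS]mulr1.
exact: ler_wpM2l.
Qed.

Lemma short_rows_col m N N' (X : 'M[R]_(N, m)) (X' : 'M[R]_(N', m)) a :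
  0 <= a <= 1 -> short_rows X -> short_rows X' ->
  short_rows (col_mx (Num.sqrt a *: X) (Num.sqrt (1 - a) *: X')).
Proof.
move=> /andP[a0 a1] hX hX' h; rewrite -[h]hsubmxK mul_row_col -!scalemxAr.
set u := lsubmx h; set v := rsubmx h.
have a1' : 0 <= 1 - a by rewrite subr_ge0.
apply: (@le_trans _ _ (Num.sqrt a * enorm u + Num.sqrt (1 - a) * enorm v)).
  apply: (le_trans (ler_normD _ _)); rewrite !normrZ !ger0_norm ?sqrtr_ge0//.
  by rewrite lerD// ler_wpM2l// sqrtr_ge0.
rewrite -ler_sqr ?nnegrE ?addr_ge0 ?mulr_ge0 ?enorm_ge0 ?sqrtr_ge0//.
rewrite enorm_sqr (_ : edot _ _ = enorm u ^+ 2 + enorm v ^+ 2); last first.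
  by rewrite !enorm_sqr /edot tr_row_mx mul_row_col mxE.
have s0 := sqr_sqrtr a0; have s1 := sqr_sqrtr a1'.
set s := Num.sqrt a in s0 *; set s' := Num.sqrt (1 - a) in s1 *.
have ss : s ^+ 2 + s' ^+ 2 = 1 by rewrite s0 s1; ring.
have := sqr_ge0 (s * enorm v - s' * enorm u).
set p := enorm u; set q := enorm v => h0.
rewrite -subr_ge0 (_ : _ - _ = (s * q - s' * p) ^+ 2 +
  (1 - (s ^+ 2 + s' ^+ 2)) * (p ^+ 2 + q ^+ 2)); last by ring.
by rewrite ss subrr mul0r addr0.
Qed.

(** Elementary tensors have a representation with [N = 1], and a convex
    combination of representations is represented on the direct sum of the
    Hilbert spaces, with weights [sqrt a] and [sqrt (1 - a)] so that their
    squares add up to 1. *)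
Lemma pi_body_hilbert m n :
  pi_body (@mx_tens R m n) (@linf_ball R m) (@linf_ball R n) `<=` [set w | hilbert_rep w].
Proof.
apply: smallest_sub => [|_ [[x y] [/= x1 y1] <-]]; last first.
  by exists 1%N, x, y; split; [|exact: short_rows1|exact: short_rows1].
apply: convex_setI => a _ _ a01 [N [X [Y [-> hX hY]]]] [N' [X' [Y' [-> hX' hY']]]].
have /andP[a0 a1] := a01; have a1' : 0 <= 1 - a by rewrite subr_ge0.
exists (N + N')%N, (col_mx (Num.sqrt a *: X) (Num.sqrt (1 - a) *: X')),
  (col_mx (Num.sqrt a *: Y) (Num.sqrt (1 - a) *: Y')).
split; [|exact: short_rows_col|exact: short_rows_col].
have trZ p q (Z : 'M[R]_(p, q)) c : (c *: Z)^T = c *: Z^T by rewrite linearZ.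
rewrite tr_col_mx mul_row_col !trZ -!scalemxAl -!scalemxAr !scalerA.
by rewrite -!expr2 !sqr_sqrtr.
Qed.

Lemma short_rows_isometry r N m (V : 'M[R]_(r, N)) (X : 'M[R]_(N, m)) :
  V *m V^T = 1%:M -> short_rows X -> short_rows (V *m X).
Proof.
move=> VV hX h; rewrite mulmxA; apply: (le_trans (hX _)).
by rewrite /enorm /edot trmx_mul mulmxA -(mulmxA h) VV mulmx1.
Qed.

(** The vectors sent into [U] by [X] form a subspace that contains the rows of
    [Y^T], because [Y^T *m X <= U]. The orthogonal projection onto it therefore
    fixes [Y^T] and can be inserted in the product. *)
Lemma hilbert_restrict N m n k (X : 'M[R]_(N, m)) (Y : 'M[R]_(N, n)) (U : 'M[R]_(k, m)) :
  short_rows X -> short_rows Y -> (Y^T *m X <= U)%MS ->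
  exists r (X' : 'M[R]_(r, m)) (Y' : 'M[R]_(r, n)),
    [/\ X'^T *m Y' = X^T *m Y, short_rows X', short_rows Y', (X' <= U)%MS & (Y' <= Y)%MS].
Proof.
move=> hX hY YXU; pose M := kermx (X *m cokermx U).
have [r [V [VV VM MV]]] := orthonormal_row_base M.
have YM : (Y^T <= M)%MS.
  by rewrite sub_kermx mulmxA -submxE.
have YV : Y^T *m V^T *m V = Y^T.
  have /submxP[D ->] := YM.
  by rewrite -[D *m M *m _]mulmxA -[LHS]mulmxA MV.
exists r, (V *m X), (V *m Y); split.
- rewrite trmx_mul -mulmxA (mulmxA V^T); congr (_ *m _).
  by rewrite -[RHS]trmxK -YV !trmx_mul !trmxK mulmxA.
- exact: short_rows_isometry.
- exact: short_rows_isometry.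
- by rewrite submxE -mulmxA -sub_kermx.
- exact: submxMl.
Qed.

(** The second restriction keeps the first one, since it replaces [X] by
    combinations of its rows. *)
Lemma hilbert_restrict2 m n k l (w : 'M[R]_(m, n)) (U : 'M[R]_(k, m)) (W : 'M[R]_(l, n)) :
  hilbert_rep w -> (w^T <= U)%MS -> (w <= W)%MS ->
  exists r (X : 'M[R]_(r, m)) (Y : 'M[R]_(r, n)),
    [/\ w = X^T *m Y, short_rows X, short_rows Y, (X <= U)%MS & (Y <= W)%MS].
Proof.
move=> [N [X [Y [wE hX hY]]]] wU wW.
have YXU : (Y^T *m X <= U)%MS by rewrite -[Y^T *m X]trmxK trmx_mul trmxK -wE.
have [r [X1 [Y1 [w1 hX1 hY1 XU _]]]] := hilbert_restrict hX hY YXU.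
have XYW : (X1^T *m Y1 <= W)%MS by rewrite w1 -wE.
have [r' [Y2 [X2 [w2 hY2 hX2 YW XX]]]] := hilbert_restrict hY1 hX1 XYW.
exists r', X2, Y2; split=> //; last exact: submx_trans XX XU.
by rewrite wE -w1 -[LHS]trmxK trmx_mul trmxK -w2 trmx_mul trmxK.
Qed.

End HilbertRepresentation.

(** * Consequences of the universal property *)

Section TensorProductFacts.
Variable R : realType.

Lemma bilinear_exists (U U' V : vectType R) (f : U -> U' -> V) :
  bilinear_for *:%R *:%R f -> exists b : {bilinear U -> U' -> V}, forall x y, b x y = f x y.
Proof.
move=> hf; pose m := bilinear_isBilinear.Build R U U' V *:%R *:%R f hf.
pose b : {bilinear U -> U' -> V} := HB.pack f m.
by exists b.
Qed.

Variables (E1 E2 T : vectType R) (t : {bilinear E1 -> E2 -> T}).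
Hypothesis ht : is_tensor_product t.

Lemma tensor_ext (V : vectType R) (f g : 'Hom(T, V)) :
  (forall x y, f (t x y) = g (t x y)) -> f = g.
Proof.
move=> fg; have [b bE] : exists b : {bilinear E1 -> E2 -> V},
    forall x y, b x y = g (t x y).
  apply: bilinear_exists; split=> [y a x x'|x a y y'].
    by rewrite linearPl linearP.
  by rewrite linearPr linearP.
have [h [_ hU]] := ht b.
by rewrite -(hU f) ?(hU g)// => x y; rewrite bE.
Qed.

(** Functionals [c k] dual to [x] induce maps [g k : T -> E2] with
    [g k (t v w) = c k v *: w], and [z |-> \sum_k t (x k) (g k z)] fixes
    elementary tensors. *)
Lemma tensor_expandl N (x : 'I_N -> E1) (c : 'I_N -> dual E1) :
  (forall v, v = \sum_k (c k v : R) *: x k) ->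
  forall z : T, exists y : 'I_N -> E2, z = \sum_k t (x k) (y k).
Proof.
move=> xc z.
have hb k : exists g : 'Hom(T, E2), forall v w, g (t v w) = (c k v : R) *: w.
  have [b bE] : exists b : {bilinear E1 -> E2 -> E2},
      forall v w, b v w = (c k v : R) *: w.
    apply: bilinear_exists; split=> [w a v v'|v a w w'].
      by rewrite /= linearP scalerDl scalerA.
    by rewrite /= scalerDr !scalerA mulrC.
  by have [g [gE _]] := ht b; exists g => v w; rewrite gE bE.
have [g gE] := choice hb.
pose F (z : T) : T := \sum_k t (x k) (g k z).
have F_lin : linear F.
  move=> a u v; rewrite /F scaler_sumr -big_split; apply: eq_bigr => k _ /=.
  by rewrite linearP linearPr.
pose FL := GRing.isLinear.Build R T T *:%R F F_lin.
pose F' : {linear T -> T} := HB.pack F FL.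
have : linfun F' = \1%VF.
  apply: tensor_ext => v w; rewrite lfunE id_lfunE /= /F.
  rewrite [in RHS](xc v) linear_sumlz; apply: eq_bigr => k _.
  by rewrite gE linearZr_LR linearZl_LR.
move=> /lfunP/(_ z); rewrite lfunE id_lfunE => <-.
by exists (fun k => g k z).
Qed.

Lemma tensor_expandr N (y : 'I_N -> E2) (c : 'I_N -> dual E2) :
  (forall v, v = \sum_k (c k v : R) *: y k) ->
  forall z : T, exists x : 'I_N -> E1, z = \sum_k t (x k) (y k).
Proof.
move=> yc z.
have hb k : exists g : 'Hom(T, E1), forall v w, g (t v w) = (c k w : R) *: v.
  have [b bE] : exists b : {bilinear E1 -> E2 -> E1},
      forall v w, b v w = (c k w : R) *: v.
    apply: bilinear_exists; split=> [w a v v'|v a w w'].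
      by rewrite /= scalerDr !scalerA mulrC.
    by rewrite /= linearP scalerDl scalerA.
  by have [g [gE _]] := ht b; exists g => v w; rewrite gE bE.
have [g gE] := choice hb.
pose F (z : T) : T := \sum_k t (g k z) (y k).
have F_lin : linear F.
  move=> a u v; rewrite /F scaler_sumr -big_split; apply: eq_bigr => k _ /=.
  by rewrite linearP linearPl.
pose FL := GRing.isLinear.Build R T T *:%R F F_lin.
pose F' : {linear T -> T} := HB.pack F FL.
have : linfun F' = \1%VF.
  apply: tensor_ext => v w; rewrite lfunE id_lfunE /= /F.
  rewrite [in RHS](yc w) linear_sumr; apply: eq_bigr => k _.
  by rewrite gE linearZr_LR linearZl_LR.
move=> /lfunP/(_ z); rewrite lfunE id_lfunE => <-.
by exists (fun k => g k z).
Qed.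

End TensorProductFacts.

(** * Polar bodies and ellipsoids *)

Section Polars.
Variable R : realType.

Lemma polarP (E : vectType R) (dot : {dot E for idfun}) (C : set E) y :
  polar dot C y <-> forall x, C x -> dot x y <= 1.
Proof.
split=> [h x Cx|h].
  rewrite -lee_fin; apply: le_trans h; apply: ereal_sup_ubound; by exists x.
by apply: ge_ereal_sup => _ [x Cx <-]; rewrite lee_fin h.
Qed.

Variables (E : vectType R) (dot : {dot E for idfun}).

Lemma dist_continuous (y : E) : continuous (fun v : 'rV[R]_(\dim {:E}) =>
  dot (passmx.vecof (vbasis {:E}) v - y) (passmx.vecof (vbasis {:E}) v - y)).
Proof.
pose e (i : 'I_(\dim {:E})) := (vbasis {:E})`_i.
rewrite (_ : (fun v => _) = (fun v : 'rV_(\dim {:E}) =>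
  (\sum_i v 0 i * (\sum_j v 0 j * dot (e i) (e j) - 2 * dot (e i) y)) + dot y y)); last first.
  apply/funext => v; set u := passmx.vecof _ v.
  have ue w : dot u w = \sum_i v 0 i * dot (e i) w.
    by rewrite dot_suml; apply: eq_bigr => i _; rewrite dotZl.
  rewrite (_ : dot _ _ = dot u u - 2 * dot u y + dot y y); last first.
    by rewrite dotBl !dotBr (dotC dot y); ring.
  congr (_ + _); rewrite !ue mulr_sumr -sumrB; apply: eq_bigr => i _.
  rewrite mulrBr mulrCA; congr (_ * _ - _).
  by rewrite dotC ue; apply: eq_bigr => j _; rewrite dotC.
have cc i : continuous (fun v : 'rV[R]_(\dim {:E}) => v 0 i : R).
  exact: coord_continuous.
have inner i : continuous (fun v : 'rV[R]_(\dim {:E}) => \sum_j v 0 j * dot (e i) (e j)).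
  apply: continuous_big => [|j _ w]; first exact: add_continuous.
  exact: (cvgM (cc j w) (cvg_cst _)).
have outer : continuous (fun v : 'rV[R]_(\dim {:E}) =>
    \sum_i v 0 i * (\sum_j v 0 j * dot (e i) (e j) - 2 * dot (e i) y)).
  apply: continuous_big => [|i _ w]; first exact: add_continuous.
  exact: (cvgM (cc i w) (cvgB (inner i w) (cvg_cst _))).
by move=> v; exact: (cvgD (outer v) (cvg_cst _)).
Qed.

(** [g] is a multiple of [y - p], where [p] is the point of [P] closest to
    [y]. *)
Lemma separation (P : set E) y : convex_set (P : set (convex_lmodType E)) ->
  compact (@coords R E @` P) -> P 0 -> ~ P y ->
  exists g, polar dot P g /\ 1 < dot y g.
Proof.
move=> cP kP P0 nPy.
have eb : basis_of fullv (vbasis {:E}) by exact: vbasisP.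
have coK x : passmx.vecof (vbasis {:E}) (coords x) = x by rewrite /coords passmx.rVofK.
have [c] : exists2 c, c \in @coords R E @` P & forall v, v \in @coords R E @` P ->
    dot (passmx.vecof (vbasis {:E}) c - y) (passmx.vecof (vbasis {:E}) c - y) <=
    dot (passmx.vecof (vbasis {:E}) v - y) (passmx.vecof (vbasis {:E}) v - y).
  apply: compact_EVT_min => //; first by exists (coords 0), 0.
  by apply: continuous_subspaceT; exact: dist_continuous.
rewrite inE => -[p Pp <-]; rewrite coK => pmin'.
have pmin x : P x -> dot (p - y) (p - y) <= dot (x - y) (x - y).
  by move=> Px; rewrite -[x in leRHS]coK; apply: pmin'; rewrite inE; exists x.
pose g0 := y - p.
have g0p : 0 < dot g0 g0.
  by apply: dot_gt0; rewrite subr_eq0; apply: contra_notN nPy => /eqP->.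
have le0 x : P x -> dot (x - p) g0 <= 0.
  move=> Px; rewrite leNgt; apply/negP => a0.
  set a := dot (x - p) g0 in a0; pose b := dot (x - p) (x - p).
  have b0 : 0 <= b by apply: dot_ge0.
  (* Moving from [p] towards [x] by a small proportion [l] would decrease the
     distance to [y]. *)
  pose l := a / (a + b); have ab0 : 0 < a + b by lra.
  have l0 : 0 < l by rewrite divr_gt0.
  have l1 : l <= 1 by rewrite ler_pdivrMr//; lra.
  have lab : l * (a + b) = a by rewrite divfK ?gt_eqF.
  have l01 : 0 <= l <= 1 by rewrite l1 ltW.
  have := pmin _ (convex_comb cP l01 Px Pp).
  have -> : l *: x + (1 - l) *: p - y = l *: (x - p) - g0.
    rewrite /g0 scalerBr scalerBl scale1r opprB -!addrA; congr (_ + _).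
    by rewrite addrCA.
  have -> : p - y = - g0 by rewrite opprB.
  have expand (m : R) (u w : E) :
      dot (m *: u - w) (m *: u - w) = m ^+ 2 * dot u u - 2 * m * dot u w + dot w w.
    by rewrite dotBl !dotBr !dotZl !dotZr (dotC dot w); ring.
  rewrite expand dotNl dotNr opprK -/a -/b => h.
  have : l * (2 * a) <= l * (l * b) by move: h; set q := dot g0 g0; lra.
  rewrite ler_pM2l//.
  have : 0 < l * a by rewrite mulr_gt0.
  by move: lab; rewrite mulrDr; lra.
set al := dot p g0.
have al0 : 0 <= al by have := le0 0 P0; rewrite dotBl dot0l sub0r oppr_le0.
have yE : dot y g0 = al + dot g0 g0 by rewrite {2}/g0 dotBl addrC subrK.
(* [s] lies strictly between the maximum [al] of [g0] on [P] and its value at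
   [y]. *)
pose s := al + dot g0 g0 / 2.
have s0 : 0 < s by rewrite /s; lra.
exists (s^-1 *: g0); split.
  apply/polarP => x Px; rewrite dotZr mulrC ler_pdivrMr// mul1r.
  by have := le0 x Px; rewrite dotBl -/al /s; lra.
by rewrite dotZr mulrC ltr_pdivlMr// mul1r yE /s; lra.
Qed.

Section SymmetricBody.
Variable P : set E.
Hypothesis hP : symmetric_body P.

Lemma symmetric_bodyN x : P x -> P (- x).
Proof. by move=> Px; rewrite -hP.2; exists x. Qed.

Lemma symmetric_body0 : P 0.
Proof.
have [[cP _ [v /interior_subset[x Px _]]] _] := hP.
have h : 0 <= (2^-1 : R) <= 1 by lra.
have := convex_comb cP h Px (symmetric_bodyN Px).
rewrite (_ : 1 - 2^-1 = 2^-1 :> R); last by field.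
by rewrite scalerN subrr.
Qed.

Lemma bipolar y : (forall g, polar dot P g -> dot y g <= 1) -> P y.
Proof.
move=> h; apply: contrapT => nPy.
have [[cP kP _] _] := hP.
have [g [gP g1]] := separation cP kP symmetric_body0 nPy.
by have := h g gP; rewrite leNgt g1.
Qed.

Lemma polarN f : polar dot P f -> polar dot P (- f).
Proof.
move=> /polarP h; apply/polarP => x Px.
by have := h _ (symmetric_bodyN Px); rewrite dotNl dotNr.
Qed.

Lemma polar_gauge f x c : polar dot P f -> (gauge_fun P x <= c%:E)%E -> dot x f <= c.
Proof.
move=> /polarP fP xc; apply/ler_addgt0Pr => e e0.
have /ereal_inf_lt[_ [l [l0 Pl] <-]] : (gauge_fun P x < (c + e)%:E)%E.
  by apply: le_lt_trans xc _; rewrite lte_fin ltrDl.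
rewrite lte_fin => le; apply: ltW; apply: le_lt_trans le.
by have := fP _ Pl; rewrite dotZl ler_pdivrMl// mulr1.
Qed.

Lemma polar_dual_norm f (phi : dual E) : polar dot P f ->
  (forall x, phi x = dot x f) -> (dual_norm (gauge_fun P) phi <= 1)%E.
Proof.
move=> fP phiE; apply: ge_ereal_sup => _ [x [_ x1] <-]; rewrite lee_fin phiE ler_norml.
rewrite (polar_gauge fP x1) andbT lerNl.
by have := polar_gauge (polarN fP) x1; rewrite dotNr.
Qed.

End SymmetricBody.

Lemma orthonormal_basis_exists : exists N (e : nat -> E), orthonormal dot N e /\
  forall v, v = \sum_(k < N) dot v (e k) *: e k.
Proof.
have [N [e [ee ve _]]] := gram_schmidt dot (fun i => (vbasis {:E})`_i) (\dim {:E}).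
exists N, e; split=> // v.
rewrite [LHS](coord_vbasis (memvf v)).
transitivity (\sum_i \sum_(k < N) coord (vbasis fullv) i v *:
    (dot (vbasis {:E})`_i (e k) *: e k)).
  by apply: eq_bigr => i _; rewrite -scaler_sumr -ve.
rewrite exchange_big; apply: eq_bigr => k _ /=.
rewrite [v in RHS](coord_vbasis (memvf v)) dot_suml scaler_suml.
by apply: eq_bigr => i _; rewrite dotZl scalerA.
Qed.

(** [x] is the image of an orthonormal basis under the bijection that defines the
    ellipsoid. It is an orthonormal basis for the gauge of [P], which gives the
    second clause, and for the dual gauge the third one: functionals with
    prescribed values [h] on [x] have dual norm [enorm h]. *)
Lemma ellipsoid_frame (P : set E) : ellipsoid dot P ->
  exists N (x : 'I_N -> E) (c : 'I_N -> dual E),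
  [/\ forall v, v = \sum_k (c k v : R) *: x k,
      forall h, (gauge_fun P (lincomb x h) <= (enorm h)%:E)%E &
      forall h, enorm h <= 1 -> exists f, polar dot P f /\ forall k, dot (x k) f = h 0 k].
Proof.
move=> [A [B BK KB] PE].
have [N [e [ee ve]]] := orthonormal_basis_exists.
have B_lin : linear B.
  by move=> a u v; apply: (can_inj BK); rewrite KB linearP /= !KB.
pose BL := GRing.isLinear.Build R E E *:%R B B_lin.
pose B' : {linear E -> E} := HB.pack B BL.
have Bsum (a : 'I_N -> R) : B (\sum_k a k *: e k) = \sum_k a k *: B (e k).
  transitivity (B' (\sum_k a k *: e k)) => //; rewrite linear_sum.
  by apply: eq_bigr => k _; rewrite linearZ.
pose c0 (k : 'I_N) (v : E) : R^o := dot (B v) (e k).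
have c0_lin k : linear (c0 k) by move=> a u v; rewrite /c0 B_lin dotDl dotZl.
pose cL k := GRing.isLinear.Build R E R^o *:%R (c0 k) (c0_lin k).
pose c k : dual E := linfun (HB.pack (c0 k) (cL k) : {linear _ -> _}).
have cE k v : c k v = dot (B v) (e k) by rewrite lfunE.
pose el (h : 'rV[R]_N) : E := \sum_k h 0 k *: e k.
have elE h : dot (el h) (el h) = enorm h ^+ 2.
  rewrite orthonormal_norm// enorm_sqr edotE.
  by apply: eq_bigr => k _; rewrite expr2.
have elZ a h : el (a *: h) = a *: el h.
  by rewrite /el scaler_sumr; apply: eq_bigr => k _; rewrite mxE scalerA.
have Pel h : enorm h <= 1 -> P (A (el h)).
  move=> h1; rewrite PE; exists (el h) => //=.
  by rewrite elE sqrtr_sqr ger0_norm ?enorm_ge0.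
have lE h : lincomb (fun k : 'I_N => A (e k)) h = A (el h).
  by rewrite /el linear_sum; apply: eq_bigr => k _; rewrite linearZ.
exists N, (fun k => A (e k)), c; split.
- move=> v; rewrite -[LHS]KB {1}(ve (B v)) linear_sum.
  by apply: eq_bigr => k _; rewrite linearZ cE.
- move=> h; apply/lee_addgt0Pr => r r0; rewrite -EFinD lE.
  have hr : 0 < enorm h + r by rewrite ltr_wpDl// enorm_ge0.
  apply: gauge_le => //; rewrite -linearZ -elZ; apply: Pel.
  rewrite enormZ gtr0_norm ?invr_gt0// ler_pdivrMl// mulr1; lra.
(* [f] is the image of [el h] under the adjoint of [B]. *)
- move=> h h1; pose f := \sum_(l < N) dot (B (e l)) (el h) *: e l.
  have dotf v : dot v f = dot (B v) (el h).
    rewrite dot_sumr [in RHS](ve v) Bsum dot_suml.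
    by apply: eq_bigr => l _; rewrite dotZr dotZl mulrC.
  exists f; split.
    apply/polarP => v; rewrite PE => -[b /= b1 <-]; rewrite dotf BK.
    pose bv : 'rV[R]_N := \row_k dot b (e k).
    have bE : b = el bv by rewrite {1}(ve b); apply: eq_bigr => k _; rewrite mxE.
    have -> : dot b (el h) = edot bv h.
      by rewrite dot_sumr edotE; apply: eq_bigr => k _; rewrite dotZr mxE mulrC.
    apply: (le_trans (ler_norm _)); apply: (le_trans (edot_enorm _ _)).
    rewrite -[leRHS]mulr1 ler_pM ?enorm_ge0//.
    by move: b1; rewrite {1}bE bE elE sqrtr_sqr ger0_norm ?enorm_ge0.
  move=> k; rewrite dotf BK dot_sumr (bigD1 k)//= big1 => [|l lk].
    by rewrite dotZr ee// eqxx mulr1 addr0.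
  by rewrite dotZr ee// val_eqE eq_sym (negPf lk) mulr0.
Qed.

End Polars.

(** * Comparison of the injective and Hilbertian bodies *)

Section Epsilon.
Variables (R : realType) (E1 E2 T : vectType R).
Variables (dot1 : {dot E1 for idfun}) (dot2 : {dot E2 for idfun}).
Variables (t : {bilinear E1 -> E2 -> T}) (dotT : {dot T for idfun}).
Hypothesis hdotT : forall x1 y1 x2 y2,
  dotT (t x1 x2) (t y1 y2) = dot1 x1 y1 * dot2 x2 y2.
Variables (P1 : set E1) (P2 : set E2).
Hypotheses (hP1 : symmetric_body P1) (hP2 : symmetric_body P2).

(** For [f] and [g] in the polars, [dotT (t f g) z] is the value of [g] on
    [T_z f], hence at most the norm of [T_z], which is at most [omega2 z] by
    factorization. *)
Lemma omega2_sub_eps :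
  omega2_body t P1 P2 `<=` eps_body t dot1 dot2 dotT P1 P2.
Proof.
move=> z z1; apply/polarP; apply: smallest_sub.
  apply: convex_setI => l x y /andP[l0 l1] xz yz /=.
  rewrite dotDl !dotZl; nra.
move=> _ [[f g] [/= fP gP] <-]; rewrite -lee_fin.
apply: le_trans z1; apply: le_ereal_inf_tmp.
move=> _ [H [dot [S [Q [nH [n [a [b [zE QS]]]] fS fQ ->]]]]].
pose phi0 (x : E1) : R^o := dot1 x f.
have phi0_lin : linear phi0 by move=> c u v; rewrite /phi0 dotDl dotZl.
pose phiL := GRing.isLinear.Build R E1 R^o *:%R phi0 phi0_lin.
pose phi : dual E1 := linfun (HB.pack phi0 phiL : {linear _ -> _}).
have phiE x : phi x = dot1 x f by rewrite lfunE.
have phi1 : (dual_norm (gauge_fun P1) phi <= 1)%E by apply: (polar_dual_norm hP1 fP).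
have -> : dotT (t f g) z = dot2 (Q (S phi)) g.
  rewrite [Q (S phi)]QS zE dot_sumr dot_suml; apply: eq_bigr => k _.
  by rewrite hdotT dotZl phiE (dotC dot1) (dotC dot2).
have S0 : (0 <= opnorm setT (dual_norm (gauge_fun P1)) (fun h : H => `|h|%:E) S)%E.
  by apply: (opnorm_ge0 (v := 0)) => //; exact: dual_norm0.
have Q0 : (0 <= opnorm setT (fun h : H => `|h|%:E) (gauge_fun P2) Q)%E.
  apply: (opnorm_ge0 (v := 0)) => //; last exact: gauge_ge0.
  by rewrite normr0 lee_fin.
have Sphi := @opnorm_unit R _ _ setT _ (fun h : H => `|h|%:E) S phi I phi1.
move: fS fQ Sphi; rewrite -!ge0_fin_numE// => /fineK <- /fineK Qs.
rewrite lee_fin => Sphi.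
have nHh : homogeneous (fun h : H => `|h|%:E).
  by split=> [|c h c0]; [rewrite normr0|rewrite normrZ gtr0_norm].
rewrite -Qs -EFinM lee_fin.
apply: (polar_gauge gP).
apply: (opnorm_bound (D := setT) nHh (gauge_homogeneous (symmetric_body0 hP2))) => //.
- by rewrite Qs.
- exact: fine_ge0.
- exact: fine_ge0.
Qed.

Lemma eps_pairing z f g : eps_body t dot1 dot2 dotT P1 P2 z ->
  polar dot1 P1 f -> polar dot2 P2 g -> dotT (t f g) z <= 1.
Proof.
move=> /polarP h fP gP; apply: h.
by apply: sub_gen_smallest; exists (f, g).
Qed.

End Epsilon.

Section EllipsoidFactor.
Variables (R : realType) (E1 E2 : vectType R).
Variables (dot1 : {dot E1 for idfun}) (dot2 : {dot E2 for idfun}).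
Variables (P1 : set E1) (P2 : set E2).

(** By the bipolar theorem it is enough to test [lincomb y h] against [g] in the
    polar of [P2], and an [f] with values [h] on [x] turns this into the
    pairing of [f] and [g] with [\sum_k x k (x) y k]. *)
Lemma frame_gauge N (x : 'I_N -> E1) (y : 'I_N -> E2) : symmetric_body P2 ->
  (forall h : 'rV[R]_N, enorm h <= 1 ->
     exists f, polar dot1 P1 f /\ forall k, dot1 (x k) f = h 0 k) ->
  (forall f g, polar dot1 P1 f -> polar dot2 P2 g ->
     \sum_k dot1 (x k) f * dot2 (y k) g <= 1) ->
  forall h, (gauge_fun P2 (lincomb y h) <= (enorm h)%:E)%E.
Proof.
move=> hP2 xf fg h; apply/lee_addgt0Pr => r r0; rewrite -EFinD.
have hr : 0 < enorm h + r by rewrite ltr_wpDl// enorm_ge0.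
apply: gauge_le => //.
pose h' := (enorm h + r)^-1 *: h.
have h'1 : enorm h' <= 1.
  by rewrite enormZ gtr0_norm ?invr_gt0// ler_pdivrMl// mulr1; lra.
have -> : (enorm h + r)^-1 *: lincomb y h = lincomb y h'.
  by rewrite /lincomb scaler_sumr; apply: eq_bigr => k _; rewrite mxE scalerA.
apply: (bipolar (dot := dot2) hP2) => g gP; have [f [fP fE]] := xf _ h'1.
rewrite dot_suml; apply: le_trans (fg f g fP gP).
by apply: ler_sum => k _; rewrite dotZl fE.
Qed.

End EllipsoidFactor.

(** * Embeddings into l_oo *)

Section Injectivity.
Variable R : realType.

Lemma pi_normZ m n (u : 'M[R]_(m, n)) a : 0 < a ->
  (pi_norm (@mx_tens R m n) (@linf_norm R m) (@linf_norm R n) (a *: u) <=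
   a%:E * pi_norm (@mx_tens R m n) (@linf_norm R m) (@linf_norm R n) u)%E.
Proof.
move=> a0; rewrite -lee_pdivrMl//; apply: le_ereal_inf_tmp.
move=> _ [k [x [y [-> ->]]]]; rewrite lee_pdivrMl//.
apply: ereal_inf_lbound; exists k, (fun i => a *: x i), y; split.
  rewrite scaler_sumr; apply: eq_bigr => i _.
  by rewrite linearZl_LR.
rewrite /linf_norm !sumEFin -EFinM mulr_sumr; congr (_%:E).
by apply: eq_bigr => i _; rewrite normrZ gtr0_norm// mulrA.
Qed.

Section Embedding.
Variables (E : vectType R) (P : set E) (d : nat) (j : 'Hom(E, 'rV[R]_d)) (M : R).
Hypotheses (P0 : P 0) (hj : linf_embedding P j M).

Lemma embedding_contraction x c : 0 <= c -> (gauge_fun P x <= c%:E)%E -> `|j x| <= c.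
Proof.
move=> c0 xc; have [_ j1 _] := hj; rewrite -lee_fin -[c]mul1r.
apply: (opnorm_bound (D := setT) (q := @linf_norm R d) (gauge_homogeneous P0)) => //.
- exact: linf_homogeneous.
- by rewrite j1.
Qed.

Lemma embeddingK x : (j^-1)%VF (j x) = x.
Proof.
by have [inj _ _] := hj; apply: lker0_lfunK; apply/lker0P.
Qed.

Lemma embedding_inv_gauge x : 0 <= M -> (gauge_fun P x <= (M * `|j x|)%:E)%E.
Proof.
move=> M0; have [_ _ jM] := hj; rewrite -[x in leLHS]embeddingK.
apply: (opnorm_bound (linf_homogeneous _ d) (gauge_homogeneous P0) _ jM) => //.
  by move=> a ax /=; exact: memvZ.
exact: memv_img (memvf x).
Qed.

(** [`|j x| <= g_P x <= M * `|j x|], and some [j x] is nonzero because [j] has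
    norm 1. *)
Lemma embedding_constant_ge1 : 1 <= M.
Proof.
have [_ j1 jM] := hj.
have M0 : 0 <= M.
  rewrite -lee_fin; apply: le_trans jM; apply: (opnorm_ge0 (v := 0)).
  - by rewrite /= mem0v.
  - by rewrite /linf_norm normr0 lee_fin.
  - exact: gauge_ge0.
have /ereal_sup_gt[_ [x [_ x1] <-]] :
    (0 < opnorm setT (gauge_fun P) (@linf_norm R d) j)%E by rewrite j1.
rewrite lte_fin => jx.
have := embedding_contraction (mulr_ge0 M0 (ltW jx)) (embedding_inv_gauge x M0).
by rewrite -[leLHS]mul1r ler_pM2r.
Qed.

Lemma range_matrix : exists k (U : 'M[R]_(k, d)),
  forall v, (v <= U)%MS <-> exists x, v = j x.
Proof.
pose b i := (vbasis {:E})`_i.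
pose U := \matrix_(i < \dim {:E}) j (b i).
have jU (i : 'I_(\dim {:E})) : (j (b i) <= U)%MS.
  by have := row_sub i U; rewrite rowK.
exists (\dim {:E}), U => v; split=> [/submxP[c ->]|[x ->]].
  exists (\sum_i c 0 i *: b i); rewrite mulmx_sum_row linear_sum.
  by apply: eq_bigr => i _; rewrite rowK linearZ.
rewrite (coord_vbasis (memvf x)) linear_sum summx_sub// => i _.
by rewrite linearZ scalemx_sub// jU.
Qed.

End Embedding.

Variables (E1 E2 T : vectType R) (t : {bilinear E1 -> E2 -> T}).
Hypothesis ht : is_tensor_product t.
Variables (P1 : set E1) (P2 : set E2) (d1 d2 : nat) (M1 M2 : R).
Variables (j1 : 'Hom(E1, 'rV[R]_d1)) (j2 : 'Hom(E2, 'rV[R]_d2)).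
Hypotheses (P10 : P1 0) (P20 : P2 0).
Hypotheses (hj1 : linf_embedding P1 j1 M1) (hj2 : linf_embedding P2 j2 M2).
Variable J : 'Hom(T, 'M[R]_(d1, d2)).
Hypothesis hJ : forall x y, J (t x y) = mx_tens (j1 x) (j2 y).

(** [T_(J z)] is the composite of the adjoint of [j1], [T_z] and [j2], and both
    maps added to a factorization are contractions. *)
Lemma omega2_embedding z :
  (omega2 (@mx_tens R d1 d2) (@linf_norm R d1) (@linf_norm R d2) (J z) <=
   omega2 t (gauge_fun P1) (gauge_fun P2) z)%E.
Proof.
apply: le_ereal_inf_tmp => _ [H [dot [S [Q [nH [n [a [b [zE QS]]]] fS fQ ->]]]]].
pose S0 (f : dual 'rV[R]_d1) : H := S (f \o j1)%VF.
have S0_lin : linear S0.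
  by move=> c f g; rewrite /S0 comp_lfunDl -comp_lfunZl linearP.
pose SL := GRing.isLinear.Build R (dual 'rV[R]_d1) H *:%R S0 S0_lin.
pose S' : {linear dual 'rV[R]_d1 -> H} := HB.pack S0 SL.
pose Q0 (h : H) : 'rV[R]_d2 := j2 (Q h).
have Q0_lin : linear Q0 by move=> c u v; rewrite /Q0 !linearP.
pose QL := GRing.isLinear.Build R H 'rV[R]_d2 *:%R Q0 Q0_lin.
pose Q' : {linear H -> 'rV[R]_d2} := HB.pack Q0 QL.
pose nHE := fun h : H => `|h|%:E.
have nHh : homogeneous nHE.
  by split=> [|c h c0]; rewrite /nHE; [rewrite normr0|rewrite normrZ gtr0_norm].
have S'0 : (0 <= opnorm setT (dual_norm (@linf_norm R d1)) nHE S')%E.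
  by apply: (opnorm_ge0 (v := 0)) => //; [exact: dual_norm0 | rewrite lee_fin].
have Q'0 : (0 <= opnorm setT nHE (@linf_norm R d2) Q')%E.
  by apply: (opnorm_ge0 (v := 0)) => //; rewrite ?/nHE ?normr0 lee_fin.
have QP0 : (0 <= opnorm setT nHE (gauge_fun P2) Q)%E.
  apply: (opnorm_ge0 (v := 0)) => //; last exact: gauge_ge0.
  by rewrite /nHE normr0 lee_fin.
have S'S : (opnorm setT (dual_norm (@linf_norm R d1)) nHE S' <=
            opnorm setT (dual_norm (gauge_fun P1)) nHE S)%E.
  apply: ge_ereal_sup => _ [f [_ f1] <-].
  apply: (@opnorm_unit R _ _ setT _ nHE S) => //.
  apply: ge_ereal_sup => _ [x [_ x1] <-]; rewrite lee_fin comp_lfunE.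
  apply: (dual_norm_bound (linf_homogeneous _ _) f1) => //.
  by rewrite lee_fin; apply: (embedding_contraction P10 hj1).
have Q'Q : (opnorm setT nHE (@linf_norm R d2) Q' <= opnorm setT nHE (gauge_fun P2) Q)%E.
  apply: ge_ereal_sup => _ [h [_ h1] <-]; move: fQ.
  rewrite -ge0_fin_numE// => /fineK Qs; rewrite -Qs lee_fin.
  apply: (embedding_contraction P20 hj2); first exact: fine_ge0.
  by rewrite Qs; exact: opnorm_unit.
apply: le_trans (lee_pmul Q'0 S'0 Q'Q S'S).
apply: ereal_inf_lbound; exists H, dot, S', Q'; split=> //.
- exists n, (fun k => j1 (a k)), (fun k => j2 (b k)); split.
    by rewrite zE linear_sum; apply: eq_bigr => k _; exact: hJ.
  move=> f; rewrite /= /Q0 /S0.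
  have -> : Q (S (f \o j1)%VF) = \sum_k ((f \o j1)%VF (a k) : R) *: b k by exact: QS.
  by rewrite linear_sum; apply: eq_bigr => k _; rewrite linearZ comp_lfunE.
- exact: le_lt_trans S'S fS.
- exact: le_lt_trans Q'Q fQ.
Qed.

(** [G] is the tensor product of the left inverses of [j1] and [j2]. *)
Lemma tensor_retraction : exists G : 'Hom('M[R]_(d1, d2), T),
  (forall u v, G (mx_tens u v) = t ((j1^-1)%VF u) ((j2^-1)%VF v)) /\
  forall z, G (J z) = z.
Proof.
have [b bE] : exists b : {bilinear 'rV[R]_d1 -> 'rV[R]_d2 -> T},
    forall u v, b u v = t ((j1^-1)%VF u) ((j2^-1)%VF v).
  apply: bilinear_exists; split=> [v a u u'|u a v v'].
    by rewrite linearP linearPl.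
  by rewrite linearP linearPr.
have [G [GE _]] := mx_tens_tensor_product b.
have GE' u v : G (mx_tens u v) = t ((j1^-1)%VF u) ((j2^-1)%VF v).
  by rewrite -bE; exact: GE.
exists G; split=> // z.
have : (G \o J)%VF = \1%VF.
  apply: (tensor_ext ht) => x y; rewrite comp_lfunE id_lfunE hJ GE'.
  by rewrite (embeddingK hj1) (embeddingK hj2).
by move=> /lfunP/(_ z); rewrite comp_lfunE id_lfunE.
Qed.

(** The representation of [J z] by contractions, once restricted to the ranges of
    [j1] and [j2], is pulled back to [z] by [G]; the division by [M1] and [M2]
    compensates the norms of the inverses. *)
Lemma pi_body_omega2 z :
  pi_body (@mx_tens R d1 d2) (@linf_ball R d1) (@linf_ball R d2) (J z) ->
  omega2_body t P1 P2 ((M1 * M2)^-1 *: z).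
Proof.
move=> /pi_body_hilbert Jz.
have [k1 [U1 U1E]] := range_matrix j1; have [k2 [U2 U2E]] := range_matrix j2.
have [n [a [c zE]]] : exists n (a : 'I_n -> E1) (c : 'I_n -> E2), z = \sum_k t (a k) (c k).
  pose cf i : dual E1 := linfun (coord (vbasis {:E1}) i : {linear E1 -> R^o}).
  have cfE v : v = \sum_i (cf i v : R) *: (vbasis {:E1})`_i.
    rewrite [LHS](coord_vbasis (memvf v)); apply: eq_bigr => i _.
    by rewrite lfunE.
  have [c zE] := tensor_expandl ht cfE z.
  by exists _, (fun i => (vbasis {:E1})`_i), c.
have Jsum : J z = \sum_k (j1 (a k))^T *m j2 (c k).
  by rewrite zE linear_sum; apply: eq_bigr => k _; exact: hJ.
have Jzl : ((J z)^T <= U1)%MS.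
  rewrite Jsum raddf_sum summx_sub// => k _; rewrite /= trmx_mul trmxK.
  by apply: mulmx_sub; apply/U1E; exists (a k).
have Jzr : (J z <= U2)%MS.
  rewrite Jsum summx_sub// => k _.
  by apply: mulmx_sub; apply/U2E; exists (c k).
have [N [X [Y [JzE hX hY XU YU]]]] := hilbert_restrict2 Jz Jzl Jzr.
have [G [GE GJ]] := tensor_retraction.
have M10 : 0 < M1 by apply: lt_le_trans (embedding_constant_ge1 P10 hj1).
have M20 : 0 < M2 by apply: lt_le_trans (embedding_constant_ge1 P20 hj2).
have bound (E : vectType R) (P : set E) d (j : 'Hom(E, 'rV[R]_d)) M k (U : 'M[R]_(k, d))
    (Z : 'M[R]_(N, d)) (h : 'rV[R]_N) : P 0 -> linf_embedding P j M -> 0 < M ->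
    (forall v, (v <= U)%MS <-> exists x, v = j x) -> (Z <= U)%MS -> short_rows Z ->
    (gauge_fun P (lincomb (fun k => M^-1 *: (j^-1)%VF (row k Z)) h) <= (1 * enorm h)%:E)%E.
  move=> P0 hj M0 UE ZU hZ.
  have -> : lincomb (fun k => M^-1 *: (j^-1)%VF (row k Z)) h = M^-1 *: (j^-1)%VF (h *m Z).
    rewrite mulmx_sum_row linear_sum scaler_sumr; apply: eq_bigr => i _.
    by rewrite [in RHS]linearZ /= !scalerA mulrC.
  have [x hx] := (UE (h *m Z)).1 (mulmx_sub _ ZU).
  rewrite hx (embeddingK hj) (gauge_homogeneous P0).2 ?invr_gt0//.
  rewrite lee_pdivrMl// mul1r -EFinM.
  apply: (le_trans (embedding_inv_gauge P0 hj x (ltW M0))).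
  by rewrite lee_fin -hx ler_pM2l.
rewrite /omega2_body /= -[1%E]mule1.
apply: (@omega2_le R _ _ _ _ _ _ N (fun k => M1^-1 *: (j1^-1)%VF (row k X))
   (fun k => M2^-1 *: (j2^-1)%VF (row k Y)) _ 1 1) => //.
- rewrite -[z]GJ JzE.
  have -> : X^T *m Y = \sum_k mx_tens (row k X) (row k Y).
    apply/matrixP => i j; rewrite summxE mxE; apply: eq_bigr => k _.
    by rewrite [RHS]mxE big_ord1 !mxE.
  rewrite linear_sum scaler_sumr; apply: eq_bigr => k _.
  rewrite linearZr_LR linearZl_LR /= scalerA invfM [in RHS]mulrC.
  by congr (_ *: _); exact: GE.
- exact: gauge_homogeneous.
- by move=> v; exact: gauge_ge0.
- by move=> h; apply: bound hX.
- by move=> h; apply: bound hY.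
Qed.

End Injectivity.

(** * Hilbertian tensor products and embeddings into l_oo *)

Unset Implicit Arguments.

Theorem corollary4p3 (R : realType)
  (E1 E2 : vectType R)
  (dot1 : {dot E1 for idfun}) (dot2 : {dot E2 for idfun})
  (* E1 (x) E2 with its scalar product *)
  (T : vectType R) (t : {bilinear E1 -> E2 -> T}) (dotT : {dot T for idfun})
  (ht : is_tensor_product t)
  (hdotT : forall x1 y1 x2 y2,
     dotT (t x1 x2) (t y1 y2) = dot1 x1 y1 * dot2 x2 y2)
  (P1 : set E1) (P2 : set E2)
  (hP1 : symmetric_body P1) (hP2 : symmetric_body P2)
  (d1 d2 : nat) (M1 M2 : R)
  (j1 : 'Hom(E1, 'rV[R]_d1)) (j2 : 'Hom(E2, 'rV[R]_d2))
  (hj1 : linf_embedding P1 j1 M1) (hj2 : linf_embedding P2 j2 M2)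
  (* J = j1 (x) j2 *)
  (J : 'Hom(T, 'M[R]_(d1, d2)))
  (hJ : forall x y, J (t x y) = mx_tens (j1 x) (j2 y)) :
  let KG := grothendieck_constant R in
  let B := J @^-1` (pi_body (@mx_tens R d1 d2) (@linf_ball R d1) (@linf_ball R d2)
                    `&` range J) in
  [/\ omega2_body t P1 P2 `<=` scale_set KG B,
      scale_set KG B `<=` scale_set (KG * M1 * M2) (omega2_body t P1 P2),
      ellipsoid dot1 P1 ->
        eps_body t dot1 dot2 dotT P1 P2 = omega2_body t P1 P2 /\
        body_equiv (KG * M1 * M2) (omega2_body t P1 P2) B
    & ellipsoid dot2 P2 ->
        eps_body t dot1 dot2 dotT P1 P2 = omega2_body t P1 P2 /\
        body_equiv (KG * M1 * M2) (omega2_body t P1 P2) B].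
Proof.
move=> KG B.
have P10 := symmetric_body0 hP1; have P20 := symmetric_body0 hP2.
have M10 : 0 < M1 by apply: lt_le_trans (embedding_constant_ge1 P10 hj1).
have M20 : 0 < M2 by apply: lt_le_trans (embedding_constant_ge1 P20 hj2).
have KG0 : 0 < KG by apply: lt_le_trans (grothendieck_constant_ge1 R).
have sub1 : omega2_body t P1 P2 `<=` scale_set KG B.
  move=> z z1; exists (KG^-1 *: z); last by rewrite scalerA mulfV ?scale1r// gt_eqF.
  split; last by exists (KG^-1 *: z).
  rewrite linearZ; apply: pi_norm_le1_body.
  apply: (le_trans (pi_normZ _ _)); first by rewrite invr_gt0.
  rewrite lee_pdivrMl//; apply: (le_trans (grothendieck_inequality _)).
  apply: lee_wpmul2l; first by rewrite lee_fin ltW.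
  exact: le_trans (omega2_embedding P10 P20 hj1 hj2 hJ z) z1.
have sub2 z : B z -> omega2_body t P1 P2 ((M1 * M2)^-1 *: z).
  by move=> [Jz _]; exact: (pi_body_omega2 ht P10 P20 hj1 hj2 hJ).
have equiv : body_equiv (KG * M1 * M2) (omega2_body t P1 P2) B.
  exists KG, (M1 * M2); split=> //; rewrite ?mulr_gt0 ?mulrA//.
  move=> z /sub2 h; exists ((M1 * M2)^-1 *: z) => //.
  by rewrite scalerA mulfV ?scale1r// gt_eqF// mulr_gt0.
split=> //.
- move=> _ [z /sub2 h <-]; exists ((M1 * M2)^-1 *: z) => //.
  by rewrite scalerA -(mulrA KG) mulfK// gt_eqF// mulr_gt0.
- move=> ell; split=> //; apply/seteqP; split; last exact: omega2_sub_eps.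
  move=> z ez; have [N [x [c [xc px xf]]]] := ellipsoid_frame ell.
  have [y zE] := tensor_expandl ht xc z.
  rewrite /omega2_body /= -[1%E]mule1; apply: (omega2_le (c1 := 1) (c2 := 1) zE) => //.
  + exact: gauge_homogeneous.
  + by move=> v; exact: gauge_ge0.
  + by move=> h; rewrite mul1r.
  + move=> h; rewrite mul1r; apply: (frame_gauge hP2 xf) => f g fP gP.
    apply: le_trans (eps_pairing ez fP gP); rewrite zE dot_sumr.
    by apply: ler_sum => k _; rewrite hdotT (dotC dot1) (dotC dot2).
- move=> ell; split=> //; apply/seteqP; split; last exact: omega2_sub_eps.
  move=> z ez; have [N [y [c [yc py yf]]]] := ellipsoid_frame ell.
  have [x zE] := tensor_expandr ht yc z.
  rewrite /omega2_body /= -[1%E]mule1; apply: (omega2_le (c1 := 1) (c2 := 1) zE) => //.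
  + exact: gauge_homogeneous.
  + by move=> v; exact: gauge_ge0.
  + move=> h; rewrite mul1r; apply: (frame_gauge hP1 yf) => g f gP fP.
    apply: le_trans (eps_pairing ez fP gP); rewrite zE dot_sumr.
    by apply: ler_sum => k _; rewrite hdotT (dotC dot1) (dotC dot2) mulrC.
  + by move=> h; rewrite mul1r.
Qed.
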